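(* The smallest length $n>1$ for which there exists a $3$-inflatable permutation of length $n$ is $n=17$. That is, there is a $3$-inflatable permutation of length $17$, and there is no $3$-inflatable permutation of length $n$ for any $2\le n\le 16$.
   Context: A permutation of length $n\ge 1$ is a bijection of $[n]=\{1,\dots,n\}$; $S_n$ is the set of these and $|\tau|$ denotes the length of $\tau$. A tuple $(a_1,\dots,a_k)$ of distinct integers is order-isomorphic to $\pi\in S_k$ if $a_i<a_j \iff \pi(i)<\pi(j)$ for all $i,j$. The density $t(\pi,\tau)$ of $\pi\in S_k$ in a permutation $\tau$ with $|\tau|\ge k$ is the probability that the restriction of $\tau$ to a uniformly random $k$-element subset of its indices (listed in increasing order of index) is order-isomorphic to $\pi$. Tensor product: for $\tau\in S_n$, $\gamma\in S_m$, $\tau[\gamma]\in S_{nm}$ is given by $\tau[\gamma]((i-1)m+j)=(\tau(i)-1)m+\gamma(j)$ for $i\in[n]$, $j\in[m]$. The random inflation of $\tau$ is the sequence of random permutations $\tau[\lambda_1],\tau[\lambda_2],\ldots$, where $\lambda_\ell$ is uniformly distributed on $S_\ell$ for each $\ell\ge1$ (all on a common probability space). A sequence of permutations $\{\tau_j\}$ with $|\tau_j|\to\infty$ whose pattern densities $t(\pi,\tau_j)$ all converge is called $k$-symmetric if $\lim_{j} t(\pi,\tau_j)=1/k!$ for every $\pi\in S_k$. A permutation $\tau$ is $k$-inflatable if its random inflation is (almost surely) $k$-symmetric. *)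

(* Defs.v *)
From HB Require Import structures.
From mathcomp Require Import all_boot all_order all_algebra all_fingroup.
From mathcomp Require Import all_classical all_reals all_analysis.
Set Implicit Arguments.
Unset Strict Implicit.
Unset Printing Implicit Defensive.
Import Order.TTheory GRing.Theory Num.Theory.
Import numFieldNormedType.Exports.
Local Open Scope classical_set_scope.
Local Open Scope ring_scope.

(* Permutations of length n are elements of 'S_n: indices and values are
   shifted from {1, ..., n} to {0, ..., n - 1}. *)

Definition order_isomorphic (a : seq nat) k (pi : 'S_k) : bool :=
  (size a == k) &&
  [forall i : 'I_k, forall j : 'I_k,
     (nth 0%N a i < nth 0%N a j)%N == (pi i < pi j)%N].

(* [enum I] lists the indices in I in increasing order. *)
Definition restriction N (tau : 'S_N) (I : {set 'I_N}) : seq nat :=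
  [seq val (tau i) | i <- enum I].

(* If N < k then no k-subset exists and the value is 0 / 0 = 0; this does not
   affect limits along lengths tending to infinity. *)
Definition density (R : realType) k (pi : 'S_k) N (tau : 'S_N) : R :=
  #|[pred I : {set 'I_N} |
      (#|I| == k) && order_isomorphic (restriction tau I) pi]|%:R
  / #|[pred I : {set 'I_N} | #|I| == k]|%:R.

Lemma block_subproof n m (x : 'I_(n * m)) : (x %/ m < n)%N.
Proof.
by case: m x => [|m] [x xlt] /=; [move: xlt; rewrite muln0 | rewrite ltn_divLR].
Qed.

Lemma offset_subproof n m (x : 'I_(n * m)) : (x %% m < m)%N.
Proof.
by case: m x => [|m] [x xlt] /=; [move: xlt; rewrite muln0 | rewrite ltn_mod].
Qed.

Lemma join_subproof n m (i : 'I_n) (j : 'I_m) : (i * m + j < n * m)%N.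
Proof.
apply: (@leq_trans (i * m + m)%N); first by rewrite ltn_add2l.
by rewrite addnC -mulSn leq_mul2r ltn_ord orbT.
Qed.

Definition block n m (x : 'I_(n * m)) : 'I_n := Ordinal (block_subproof x).
Definition offset n m (x : 'I_(n * m)) : 'I_m := Ordinal (offset_subproof x).
Definition join_ord n m (i : 'I_n) (j : 'I_m) : 'I_(n * m) :=
  Ordinal (join_subproof i j).

Lemma block_join n m (i : 'I_n) (j : 'I_m) : block (join_ord i j) = i.
Proof.
apply: val_inj => /=; case: m j => [[]//|m] j.
by rewrite divnMDl // divn_small ?addn0.
Qed.

Lemma offset_join n m (i : 'I_n) (j : 'I_m) : offset (join_ord i j) = j.
Proof. by apply: val_inj => /=; rewrite modnMDl modn_small. Qed.

Lemma join_block_offset n m (x : 'I_(n * m)) :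
  join_ord (block x) (offset x) = x.
Proof. by apply: val_inj => /=; rewrite -divn_eq. Qed.

Definition tensor_fun n m (tau : 'S_n) (gamma : 'S_m) (x : 'I_(n * m)) :
    'I_(n * m) :=
  join_ord (tau (block x)) (gamma (offset x)).

Lemma tensor_fun_inj n m (tau : 'S_n) (gamma : 'S_m) :
  injective (tensor_fun tau gamma).
Proof.
move=> x y exy; rewrite -(join_block_offset x) -(join_block_offset y).
have /perm_inj -> : tau (block x) = tau (block y).
  by have := congr1 (@block n m) exy; rewrite !block_join.
have /perm_inj -> // : gamma (offset x) = gamma (offset y).
by have := congr1 (@offset n m) exy; rewrite !offset_join.
Qed.

Definition tensor n m (tau : 'S_n) (gamma : 'S_m) : 'S_(n * m) :=
  perm (@tensor_fun_inj n m tau gamma).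

Lemma tensorE n m (tau : 'S_n) (gamma : 'S_m) (i : 'I_n) (j : 'I_m) :
  tensor tau gamma (join_ord i j) = (tau i * m + gamma j)%N :> nat.
Proof. by rewrite permE /tensor_fun block_join offset_join. Qed.

Definition symmetric_seq (R : realType) (k : nat)
    (len : nat -> nat) (tau : forall j, 'S_(len j)) : Prop :=
  [/\ len j @[j --> \oo] --> \oo,
      forall (m : nat) (pi : 'S_m), (0 < m)%N ->
        cvg (density R pi (tau j) @[j --> \oo]) &
      forall pi : 'S_k,
        density R pi (tau j) @[j --> \oo] --> (k`!%:R^-1 : R)].

Definition uniform_perm (R : realType) d (Omega : measurableType d)
    (P : probability Omega R) l (lambda : Omega -> 'S_l) : Prop :=
  forall sigma : 'S_l,
    measurable (lambda @^-1` [set sigma]) /\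
    P (lambda @^-1` [set sigma]) = (l`!%:R^-1)%:E.

(* [lambda l] has length l.+1, so that the lengths range over all integers
   at least 1.  No joint law of the lambda's is prescribed, so the almost sure
   property is required for every coupling on a common probability space. *)
Definition inflatable (R : realType) (k n : nat) (tau : 'S_n) : Prop :=
  forall (d : measure_display) (Omega : measurableType d)
         (P : probability Omega R) (lambda : forall l : nat, Omega -> 'S_l.+1),
    (forall l, uniform_perm P (lambda l)) ->
    {ae P, forall omega,
       @symmetric_seq R k (fun l => n * l.+1)%N
         (fun l => tensor tau (lambda l omega))}.

(* Main.v *)
Require Import Defs.
From mathcomp Require Import all_boot all_order all_algebra all_fingroup.
From mathcomp Require Import all_classical all_reals all_analysis.
From HB Require Import structures.
From mathcomp Require Import ring lra zify.

(** A word of [m] points of [tau[lambda]] is a pair of words: its blocks [b] in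
['I_n] and its offsets [o] in ['I_l].  Positions compare as the pairs [(b, o)]
and values as the pairs [(tau b, lambda o)], both lexicographically.  When [l]
is large the offsets are distinct up to a negligible proportion, and for a
uniform [lambda] the order types [alpha] of [o] and [beta] of [lambda o] are
independent and uniform on ['S_m].  So the mean density of a pattern [pi] tends
to [inflation_weight tau pi / (m! n^m)], where [inflation_weight tau pi] is the
number of triples [(b, alpha, beta)] such that [(b, alpha)] increases and
[(tau b, beta)] is ordered like [pi] ([sum_tensor_count],
[mean_pattern_frequency_cvg]).

The density of [pi] is also close to its mean: a transposition of two values of
[lambda] changes it by O(1/l), and revealing the values of [lambda] one by one
gives tails that are exponentially small in [l] ([concentration]).  They are
summable, so the Borel-Cantelli lemma yields almost sure convergence under every
coupling ([density_cvg_ae]).  A coupling exists on the unit interval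
([unit_perm_uniform]), hence [tau] is k-inflatable if and only if
[inflation_weight tau pi = n^k] for all [pi] in ['S_k] ([inflatableP]).

For k = 3 the words [b] with three, two or one distinct letters give
[inflation_weight tau pi = 36 T + 9 Q + n], where [T] counts the occurrences of
[pi] in [tau] and [Q] certain ascending or descending pairs
([inflation_weight3E]).  Let [A] be the number of ascending pairs.  Counting the
extensions of ascending pairs to triples turns the equations into
[4 A = n (n - 1)], and the equation for the pattern 132, which reads
[36 T + 9 A + n = n^3], becomes [144 T = n (n - 1) (4 n - 5)].  As [4 n - 5] is
odd, 16 divides [n (n - 1)], and in the range from 2 to 16 only [n = 16] is
left; there the right-hand side is not a multiple of 9.  For [n = 17] the
permutation [perm17] satisfies all six equations. *)

Set Implicit Arguments.
Unset Strict Implicit.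
Unset Printing Implicit Defensive.
Import Order.TTheory GRing.Theory Num.Theory.
Import numFieldNormedType.Exports.
Local Open Scope ring_scope.

(** * Order types and equidistribution *)

(** The relation is meant as a strict order on the indices, and [pi] lists the
    ranks. *)
Definition agrees m (r : rel 'I_m) (pi : 'S_m) : bool :=
  [forall i, forall j, r i j == (pi i < pi j)%N].

Definition ltrel m (v : 'I_m -> nat) : rel 'I_m := fun i j => (v i < v j)%N.

(** The order of the points of an inflation: [b] gives blocks, [o] offsets. *)
Definition lexlt m (b o : 'I_m -> nat) : rel 'I_m :=
  fun i j => (b i < b j)%N || (b i == b j) && (o i < o j)%N.

(** The permutation ordered like [v]; the default value [1] occurs only for [v]
    not injective. *)
Definition standardization m (v : 'I_m -> nat) : 'S_m :=
    odflt 1%g [pick a | agrees (ltrel v) a].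

Lemma agreesP m (r : rel 'I_m) (pi : 'S_m) :
  reflect (forall i j, r i j = (pi i < pi j)%N) (agrees r pi).
Proof.
apply: (iffP forallP) => [h i j|h i]; first by apply/eqP; have /forallP := h i.
by apply/forallP => j; rewrite h.
Qed.

Lemma eq_agrees m (r r' : rel 'I_m) pi : r =2 r' -> agrees r pi = agrees r' pi.
Proof. by move=> e; apply: eq_forallb => i; apply: eq_forallb => j;
  rewrite e. Qed.

(** A permutation can be read off its comparisons, since each value is its own
    rank. *)
Lemma perm_rank m (a : 'S_m) i : #|[pred j | a j < a i]%N| = a i.
Proof.
have -> : #|[pred j | a j < a i]%N| = #|[pred k : 'I_m | k < a i]%N|.
  rewrite -(fintype.card_image (@perm_inj _ a)); apply: eq_card => k.
  rewrite !inE; apply/fintype.imageP/idP => [[j]|];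
    first by rewrite !inE => jlt ->.
  by move=> klt; exists (a^-1 k)%g; rewrite ?inE permKV.
have {2}-> : val (a i) = #|'I_(a i)| by rewrite card_ord.
have le : (a i <= m)%N by apply: ltnW.
rewrite -(fintype.card_image (f := widen_ord le)).
  apply: eq_card => k; rewrite !inE; apply/idP/fintype.imageP => [klt|[j _ ->]].
    by exists (Ordinal klt) => //; apply: val_inj.
  by rewrite /= ltn_ord.
by move=> x y /(congr1 val) /= e; apply: val_inj.
Qed.

Lemma agrees_inj m (r : rel 'I_m) a b : agrees r a -> agrees r b -> a = b.
Proof.
move=> /agreesP ha /agreesP hb; apply/permP => i; apply: ord_inj.
by rewrite -(perm_rank a i) -(perm_rank b i); apply: eq_card => j;
  rewrite !inE -ha -hb.
Qed.

(** Existence: the ranks of the values of [v] form a permutation. *)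
Lemma agrees_standardization m (v : 'I_m -> nat) : injective v ->
    agrees (ltrel v) (standardization v).
Proof.
move=> v_inj; rewrite /standardization; case: pickP => // none; exfalso.
have rk_lt i : (#|[pred j | v j < v i]%N| < m)%N.
  rewrite -[ltnRHS]card_ord; apply/proper_card/properP; split.
    by apply/fintype.subsetP.
  by exists i; rewrite // inE ltnn.
have rk_mono i j : (v i < v j)%N ->
    (#|[pred k | v k < v i]%N| < #|[pred k | v k < v j]%N|)%N.
  move=> ij; apply/proper_card/properP; split.
    by apply/fintype.subsetP => k; rewrite !inE => /ltn_trans; apply.
  by exists i; rewrite !inE ?ltnn.
have rk_inj : injective (fun i => Ordinal (rk_lt i)).
  move=> i j /(congr1 val) /= e; apply: v_inj.
  by case: (ltngtP (v i) (v j)) => // /rk_mono; rewrite e ltnn.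
suff ag : agrees (ltrel v) (perm rk_inj).
  by have := none (perm rk_inj); rewrite /= ag.
apply/agreesP => i j.
rewrite !permE /= /ltrel; apply/idP/idP => [|]; first exact: rk_mono.
by case: (ltngtP (v i) (v j)) => // [/rk_mono h /(ltn_trans h)|/v_inj ->];
  rewrite ltnn.
Qed.

Lemma ltn_standardization m (v : 'I_m -> nat) i j :
  injective v -> (standardization v i < standardization v j)%N = (v i < v j)%N.
Proof. by move=> /agrees_standardization/agreesP/(_ i j). Qed.

Lemma standardization_comp m (v : 'I_m -> nat) (g : 'S_m) :
  injective v -> standardization (fun i => v (g i)) = (g * standardization v)%g.
Proof.
move=> v_inj; have vg_inj : injective (fun i => v (g i)).
  by move=> i j /v_inj/perm_inj.
apply: (agrees_inj (agrees_standardization vg_inj)); apply/agreesP => i j.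
by rewrite !permM ltn_standardization.
Qed.

Lemma agrees_lexlt_standardization m (b o : 'I_m -> nat) pi : injective o ->
  agrees (lexlt b o) pi = agrees (lexlt b (fun i => standardization o i)) pi.
Proof. by move=> oi; apply: eq_agrees => i j;
  rewrite /lexlt ltn_standardization. Qed.

(** If order types can be multiplied by any [c] through an injection of [D]
    into itself, then no type is rarer than another, so the type is uniform on
    ['S_m]. *)
Lemma card_equidistributed (T : finType) (D : {pred T}) m (ot : T -> 'S_m)
    (g : 'S_m -> T -> T) (R : {pred 'S_m}) :
    (forall c, injective (g c)) ->
    (forall c y, y \in D -> g c y \in D) ->
    (forall c y, y \in D -> ot (g c y) = (c * ot y)%g) ->
  (m`! * #|[pred y in D | ot y \in R]| = #|D| * #|R|)%N.
Proof.
move=> g_inj gD got.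
pose cl a := #|[pred y in D | ot y == a]|.
have le_cl a b : (cl a <= cl b)%N.
  rewrite /cl -(fintype.card_image (g_inj (b * a^-1)%g));
    apply/subset_leq_card/fintype.subsetP => x.
  case/fintype.imageP => y; rewrite inE => /andP[yD /eqP ya] ->.
  by rewrite inE gD //= got // ya mulgKV.
have clE a : cl a = cl 1%g by apply/eqP; rewrite eqn_leq !le_cl.
have sumE (Q : {pred 'S_m}) : #|[pred y in D | ot y \in Q]| = (#|Q| * cl 1%g)%N.
  rewrite -sum1_card (partition_big ot (mem Q)) => [|y]; last first.
    by rewrite inE => /andP[].
  rewrite -sum_nat_const; apply: eq_bigr => a aQ.
  rewrite -(clE a) /cl -sum1_card; apply: eq_bigl => y; rewrite !inE.
  by case: eqP => [->|_]; rewrite ?andbF // (aQ : a \in Q) !andbT.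
have -> : #|D| = #|[pred y in D | ot y \in predT]|.
  by apply: eq_card => y; rewrite !inE andbT.
have cS : #|(predT : {pred 'S_m})| = m`! by exact: card_Sn.
by rewrite !sumE cS -mulnA [(cl 1%g * _)%N]mulnC.
Qed.

(** Extend one value at a time, correcting the permutation by a transposition
    that does not touch the values already matched. *)
Lemma perm_extends l m (o v : 'I_m -> 'I_l) : injective o -> injective v ->
  exists r : 'S_l, forall i, r (o i) = v i.
Proof.
move=> o_inj v_inj.
have ext K : exists r : 'S_l, forall i : 'I_m, (i < K)%N -> r (o i) = v i.
  elim: K => [|k [r IH]]; first by exists 1%g.
  case: (ltnP k m) => [km|mk]; last first.
    by exists r => i _; apply: IH; apply: leq_trans mk.
  pose k' := Ordinal km; exists (r * tperm (r (o k')) (v k'))%g => i.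
  rewrite permM ltnS leq_eqVlt => /orP[/eqP ik|ik].
    have -> : i = k' by apply: val_inj.
    by rewrite tpermL.
  have ne : i != k' by apply: contraTneq ik => ->; rewrite ltnn.
  have ne1 : r (o k') != r (o i).
    by rewrite (inj_eq perm_inj) (inj_eq o_inj) eq_sym.
  have ne2 : v k' != r (o i) by rewrite IH // (inj_eq v_inj) eq_sym.
  by rewrite tpermD //; apply: IH.
by have [r hr] := ext m; exists r => i; apply: hr.
Qed.

(** For fixed distinct positions [o], the values of a uniform permutation at
    [o] are in uniform relative order: permuting the positions permutes the
    order types. *)
Lemma card_perm_standardization l m (o : 'I_m -> 'I_l) (R : {pred 'S_m}) :
    injective o ->
  (m`! * #|[pred la : 'S_l | standardization (fun i => la (o i)) \in R]| =
    l`! * #|R|)%N.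
Proof.
move=> o_inj.
have /fin_all_exists [r hr] : forall c : 'S_m, exists r : 'S_l, forall i,
  r (o i) = o (c i).
  by move=> c; apply: perm_extends => // i j /o_inj/perm_inj.
have cS : #|(predT : {pred 'S_l})| = l`! by exact: card_Sn.
rewrite -cS -(@card_equidistributed _ predT m
  (fun la : 'S_l => standardization (fun i => la (o i)))
    (fun c la => (r c * la)%g) R) //.
  by move=> c; apply: mulgI.
move=> c la _; rewrite -(standardization_comp c).
  by congr standardization; apply: funext => i; rewrite permM hr.
by move=> i j /val_inj/perm_inj/o_inj.
Qed.

(** Permuting the letters of a uniform injective word permutes its order types.
    *)
Lemma card_inj_standardization l m (R : {pred 'S_m}) :
  (m`! * #|[pred o : {ffun 'I_m -> 'I_l} | injectiveb o &&
    (standardization (fun i => o i) \in R)]|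
   = l ^_ m * #|R|)%N.
Proof.
have -> : l ^_ m = #|[set f : {ffun 'I_m -> 'I_l} | injectiveb f]|.
  by rewrite card_inj_ffuns !card_ord.
rewrite -(@card_equidistributed _
  (mem [set f : {ffun 'I_m -> 'I_l} | injectiveb f]) m
  (fun o : {ffun 'I_m -> 'I_l} => standardization (fun i => o i))
    (fun c o => [ffun i => o (c i)]) R).
- by congr (_ * _)%N; apply: eq_card => o; rewrite !inE.
- move=> c o o' /ffunP e; apply/ffunP => i.
  by have := e (c^-1 i)%g; rewrite !ffunE permKV.
- move=> c o; rewrite !inE => /injectiveP oi; apply/injectiveP => i j.
  by rewrite !ffunE => /oi/perm_inj.
move=> c o; rewrite inE => /injectiveP oi; rewrite -(standardization_comp c).
  by congr standardization; apply: funext => i; rewrite ffunE.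
by move=> i j /val_inj/oi.
Qed.

(** * Patterns of a tensor product as pairs of words *)

Lemma sorted_enum_ord N (I : {set 'I_N}) :
    sorted (fun a b : 'I_N => a < b)%N (enum I).
Proof.
have tr : transitive (fun a b : 'I_N => a < b)%N by move=> y x z;
  apply: ltn_trans.
rewrite {1}/enum_mem -enumT; apply: sorted_filter => //.
by rewrite -(sorted_map (f := val) (e' := ltn)) val_enum_ord iota_ltn_sorted.
Qed.

Lemma enum_increasing N m (x : {ffun 'I_m -> 'I_N}) :
    agrees (ltrel (fun i => x i)) 1%g ->
  enum [set x i | i : 'I_m] = [seq x i | i <- enum 'I_m].
Proof.
move=> /agreesP x_inc.
apply: (irr_sorted_eq (leT := fun a b : 'I_N => a < b)%N).
- by move=> b a c; apply: ltn_trans.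
- by move=> a; rewrite ltnn.
- exact: sorted_enum_ord.
- rewrite sorted_map; have := sorted_enum_ord [set: 'I_m].
  rewrite (eq_enum (B := 'I_m)) => [|i]; last by rewrite inE.
  by apply: sub_sorted => i j ij; have := x_inc i j;
    rewrite !perm1 /ltrel /= => ->.
move=> y; rewrite mem_enum; apply/imsetP/mapP => [[i _ ->]|[i _ ->]].
  by exists i; rewrite // mem_enum.
by exists i.
Qed.

Lemma increasing_inj N m (x : {ffun 'I_m -> 'I_N}) :
  agrees (ltrel (fun i => x i)) 1%g -> injective x.
Proof.
move=> /agreesP x_inc i j e; apply: ord_inj.
have := x_inc i j; have := x_inc j i; rewrite /ltrel e !ltnn !perm1.
by case: ltngtP.
Qed.

Lemma order_isomorphic_image N (sg : 'S_N) m (pi : 'S_m)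
    (x : {ffun 'I_m -> 'I_N}) :
  agrees (ltrel (fun i => x i)) 1%g ->
  order_isomorphic (restriction sg [set x i | i : 'I_m]) pi
    = agrees (ltrel (fun i => sg (x i))) pi.
Proof.
move=> x_inc; rewrite /order_isomorphic /restriction enum_increasing //
  -map_comp.
rewrite size_map -cardE card_ord eqxx /=.
have nthE (i : 'I_m) : nth 0%N [seq (val \o sg \o x) k | k <- enum 'I_m] i =
  sg (x i).
  by rewrite (nth_map i) ?nth_ord_enum // -cardE card_ord.
by apply: eq_forallb => i; apply: eq_forallb => j; rewrite !nthE.
Qed.

(** An [m]-subset of indices is the image of exactly one increasing word. *)
Lemma card_patterns N (sg : 'S_N) m (pi : 'S_m) :
  #|[pred I : {set 'I_N} | (#|I| == m) &&
    order_isomorphic (restriction sg I) pi]|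
  = #|[pred x : {ffun 'I_m -> 'I_N} |
        agrees (ltrel (fun i => x i)) 1%g &&
          agrees (ltrel (fun i => sg (x i))) pi]|.
Proof.
pose h (x : {ffun 'I_m -> 'I_N}) := [set x i | i : 'I_m].
rewrite -[RHS](@card_in_image _ _ h); last first.
  move=> x y; rewrite !inE => /andP[xi _] /andP[yi _] e.
  have := enum_increasing xi;
    rewrite -[[set x i | i : 'I_m]]/(h x) e /h enum_increasing //.
  by move=> /eq_in_map eq; apply/ffunP => i; rewrite eq // mem_enum.
apply: eq_card => I; apply/idP/fintype.imageP => [|[x]]; last first.
  rewrite inE => /andP[xi xp] ->;
    rewrite inE order_isomorphic_image // xp andbT.
  by rewrite card_imset ?card_ord //; apply: increasing_inj.
rewrite inE => /andP[/eqP Im oI].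
have szI : size (enum I) = m by rewrite -cardE.
pose x : {ffun 'I_m -> 'I_N} := [ffun i => enum_val (cast_ord (esym Im) i)].
have hx : h x = I.
  apply/setP => y; apply/imsetP/idP => [[i _ ->]|yI].
    by rewrite ffunE; apply: enum_valP.
  exists (cast_ord Im (enum_rank_in yI y)) => //.
  by rewrite ffunE cast_ordK enum_rankK_in.
have x_inc : agrees (ltrel (fun i => x i)) 1%g.
  apply/agreesP => i j; rewrite !perm1 /ltrel.
  have [y0 nthE] : exists y0, forall k, x k = nth y0 (enum I) k.
    by exists (x i) => k; rewrite [LHS]ffunE (enum_val_nth (x i)).
  rewrite !nthE.
  have tr : transitive (fun a b : 'I_N => a < b)%N by move=> b a c;
    apply: ltn_trans.
  have mono := sorted_ltn_nth tr y0 (sorted_enum_ord I).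
  case: (ltngtP i j) => [ij|ji|->]; last exact: ltnn.
    by apply: mono; rewrite // inE szI.
  by apply/negbTE; rewrite -leqNgt ltnW //; apply: mono; rewrite // inE szI.
by exists x; rewrite // inE x_inc -order_isomorphic_image // -/(h x) hx.
Qed.

Lemma ltn_block l (i i' j j' : nat) : (j < l)%N -> (j' < l)%N ->
  (i * l + j < i' * l + j')%N = (i < i')%N || (i == i') && (j < j')%N.
Proof.
move=> jl j'l; case: (ltngtP i i') => [ii'|i'i|->] /=;
  last by rewrite ltn_add2l.
  apply: (@leq_trans (i.+1 * l)); first by rewrite mulSn addnC ltn_add2r.
  by apply: leq_trans (leq_addr _ _); rewrite leq_mul2r ii' orbT.
apply/negbTE; rewrite -leqNgt; apply: (@leq_trans (i'.+1 * l)).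
  by rewrite mulSn addnC leq_add2r ltnW.
by apply: leq_trans (leq_addr _ _); rewrite leq_mul2r i'i orbT.
Qed.

(** The word of points [(b, o)] is increasing and its image under [tensor tau
    la] is ordered like [pi]. *)
Definition fits n l m (tau : 'S_n) (la : 'S_l) (pi : 'S_m)
    (b : {ffun 'I_m -> 'I_n}) (o : {ffun 'I_m -> 'I_l}) : bool :=
  agrees (lexlt (fun i => b i) (fun i => o i)) 1%g &&
  agrees (lexlt (fun i => tau (b i)) (fun i => la (o i))) pi.

Definition tensor_count n l m (tau : 'S_n) (pi : 'S_m) (la : 'S_l) : nat :=
  \sum_(b : {ffun 'I_m -> 'I_n}) #|[pred o | fits tau la pi b o]|.

Lemma card_patterns_tensor n l m (tau : 'S_n) (la : 'S_l) (pi : 'S_m) :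
  #|[pred I : {set 'I_(n * l)} |
      (#|I| == m) && order_isomorphic (restriction (tensor tau la) I) pi]|
  = tensor_count tau pi la.
Proof.
rewrite card_patterns -sum1_card big_mkcond /=.
pose h (p : {ffun 'I_m -> 'I_n} * {ffun 'I_m -> 'I_l}) :=
  [ffun i => join_ord (p.1 i) (p.2 i)].
rewrite (reindex h) /=; last first.
  exists (fun x => ([ffun i => block (x i)], [ffun i => offset (x i)])) =>
    [[b o] _|x _].
    by congr (_, _); apply/ffunP => i;
      rewrite !ffunE /= ?block_join ?offset_join.
  by apply/ffunP => i; rewrite !ffunE /= join_block_offset.
transitivity (\sum_(b : {ffun 'I_m -> 'I_n}) \sum_(o : {ffun 'I_m -> 'I_l})
    if fits tau la pi b o then 1 else 0)%N; last first.
  by apply: eq_bigr => b _; rewrite -big_mkcond sum1_card.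
rewrite pair_big; apply: eq_bigr => -[b o] _ /=; congr (if _ then _ else _).
rewrite inE; congr (_ && _); apply: eq_agrees => i j;
  rewrite /ltrel /lexlt !ffunE.
  exact: ltn_block.
by rewrite !tensorE; apply: ltn_block.
Qed.

Lemma densityE (R : realType) n l m (tau : 'S_n) (la : 'S_l) (pi : 'S_m) :
  density R pi (tensor tau la) = (tensor_count tau pi la)%:R / 'C(n * l, m)%:R.
Proof.
rewrite /density card_patterns_tensor; congr (_ / _%:R).
by rewrite -[in RHS](card_ord (n * l)) -card_draws; apply: eq_card => I;
  rewrite !inE.
Qed.

(** * Concentration on the symmetric group *)

Definition mean (R : realType) N (f : 'S_N -> R) : R := (\sum_s f s) / N`!%:R.

(** Transpositions act on the values. *)
Definition swap_lipschitz (R : realType) N (c : R) (f : 'S_N -> R) : Prop :=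
  forall s a b, `|f (s * tperm a b)%g - f s| <= c.

Lemma lift_perm_bij N :
  bijective (fun p : 'I_N.+1 * 'S_N => lift_perm ord0 p.1 p.2).
Proof.
apply: inj_card_bij => [[j s] [k t] /= /permP e|].
  have jk : j = k by have := e ord0; rewrite !lift_perm_id.
  congr (_, _) => //; apply/permP => i; have := e (lift ord0 i).
  by rewrite !lift_perm_lift jk => /lift_inj.
by rewrite card_prod !card_Sn card_ord factS.
Qed.

Lemma sum_lift_perm (V : nmodType) N (f : 'S_N.+1 -> V) j :
  \sum_(s : 'S_N.+1 | s ord0 == j) f s = \sum_(s : 'S_N) f (lift_perm ord0 j s).
Proof.
rewrite (reindex _ (onW_bij _ (lift_perm_bij N))) /=.
rewrite (eq_bigl (fun p => (p.1 == j) && predT p.2)) => [|p]; last first.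
  by rewrite lift_perm_id andbT.
by rewrite -(pair_big (pred1 j) predT (fun i s => f (lift_perm ord0 i s))) /=
  big_pred1_eq.
Qed.

(** Conditioning on the value at [ord0]. *)
Lemma mean_lift_perm (R : realType) N (f : 'S_N.+1 -> R) :
  mean f = (\sum_j mean (fun s => f (lift_perm ord0 j s))) / N.+1%:R.
Proof.
rewrite /mean (partition_big (fun s : 'S_N.+1 => s ord0) predT) //= -mulr_suml.
rewrite factS natrM invfM mulrA mulrAC; congr (_ / _ / _).
by apply: eq_bigr => j _; rewrite sum_lift_perm.
Qed.

Lemma meanB (R : realType) N (f g : 'S_N -> R) :
  mean f - mean g = mean (fun s => f s - g s).
Proof. by rewrite /mean sumrB mulrBl. Qed.

Lemma mean_le (R : realType) N (f g : 'S_N -> R) :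
  (forall s, f s <= g s) -> mean f <= mean g.
Proof. by move=> fg; rewrite ler_wpM2r ?invr_ge0 ?ler0n// ler_sum. Qed.

Lemma mean_cst (R : realType) N (c : R) : mean (fun _ : 'S_N => c) = c.
Proof.
have f0 : N`!%:R != 0 :> R by rewrite pnatr_eq0 -lt0n fact_gt0.
by rewrite /mean sumr_const card_Sn -[c *+ _]mulr_natr mulfK.
Qed.

Lemma meanZ (R : realType) N (c : R) (f : 'S_N -> R) :
  mean (fun s => c * f s) = c * mean f.
Proof. by rewrite /mean -mulr_sumr mulrA. Qed.

Lemma mean_norm_le (R : realType) N (f : 'S_N -> R) c :
  (forall s, `|f s| <= c) -> `|mean f| <= c.
Proof.
move=> fc; rewrite ler_norml; apply/andP; split.
  rewrite -(mean_cst N (- c)); apply: mean_le => s.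
  by have := fc s; rewrite ler_norml => /andP[].
rewrite -(mean_cst N c); apply: mean_le => s.
by have := fc s; rewrite ler_norml => /andP[].
Qed.

(** After one value is revealed, a swap of two remaining values is still a
    swap, so the same bound serves in the induction. *)
Lemma lift_perm_lipschitz (R : realType) N c (f : 'S_N.+1 -> R) j :
  swap_lipschitz c f -> swap_lipschitz c (fun s => f (lift_perm ord0 j s)).
Proof.
move=> fc s a b.
have <- : (lift_perm ord0 j s * tperm (lift j a) (lift j b) =
  lift_perm ord0 j (s * tperm a b))%g.
  rewrite -(lift_permM _ j); congr (_ * _)%g; apply/permP => k.
  case: (unliftP j k) => [k'|] ->.
    by rewrite lift_perm_lift inj_tperm //; apply: lift_inj.
  by rewrite lift_perm_id tpermD // eq_sym neq_lift.
exact: fc.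
Qed.

(** Composing with [tperm i j] matches the permutations that send [ord0] to [i]
    with those that send it to [j], so revealing one value moves the
    conditional mean by at most [c]. *)
Lemma mean_lift_close (R : realType) N c (f : 'S_N.+1 -> R) i j :
  swap_lipschitz c f ->
  `|mean (fun s => f (lift_perm ord0 i s))
    - mean (fun s => f (lift_perm ord0 j s))| <= c.
Proof.
move=> fc.
have eqj : \sum_(s : 'S_N) f (lift_perm ord0 j s)
    = \sum_(s : 'S_N) f (lift_perm ord0 i s * tperm i j)%g.
  rewrite -sum_lift_perm -(sum_lift_perm (fun s => f (s * tperm i j)%g)).
  rewrite (reindex_inj (mulIg (tperm i j))); apply: eq_bigl => s.
  by rewrite permM -(inj_eq (@perm_inj _ (tperm i j))) tpermK tpermR.
rewrite {2}/mean eqj -/(mean _) meanB; apply: mean_norm_le => s.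
by rewrite distrC; apply: fc.
Qed.

(** From [1 - y <= expR (- y)] and [(1 + y + 2 y^2) (1 - y) = 1 + y^2 (1 - 2
    y)]. *)
Lemma expR_le_quad (R : realType) (y : R) :
  y <= 2^-1 -> expR y <= 1 + y + 2 * y ^+ 2.
Proof.
move=> yle; have h : 0 < 1 - y by lra.
have e1 : expR y * (1 - y) <= 1.
  have := expR_ge1Dx (- y); rewrite -(ler_pM2l (expR_gt0 y)) expRN divff //.
  by rewrite gt_eqF // expR_gt0.
have e2 : 1 <= (1 + y + 2 * y ^+ 2) * (1 - y).
  have : 0 <= y ^+ 2 * (1 - 2 * y) by rewrite mulr_ge0 ?sqr_ge0 //; lra.
  by rewrite -subr_ge0; congr (0 <= _); ring.
by rewrite -(ler_pM2r h); apply: le_trans e2.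
Qed.

(** Exponential moments of a martingale with bounded increments. Each revealed
    value contributes a centred variable of absolute value at most [t c], whose
    exponential moment is at most [1 + 2 (t c)^2] because the linear term of
    [expR_le_quad] averages out. *)
Lemma mean_expR (R : realType) N (f : 'S_N -> R) c t :
  swap_lipschitz c f -> 0 <= t -> t * c <= 2^-1 ->
  mean (fun s => expR (t * (f s - mean f))) <= (1 + 2 * (t * c) ^+ 2) ^+ N.
Proof.
move=> + t0 tc; elim: N f => [|N IH] f fc.
  have s1 (s : 'S_0) : s = 1%g by apply/permP => -[].
  have mf : mean f = f 1%g.
    rewrite -[RHS](mean_cst 0); congr mean.
    by apply: funext => s; rewrite (s1 s).
  rewrite expr0 -[leRHS](mean_cst 0); apply: mean_le => s.
  by rewrite (s1 s) mf subrr mulr0 expR0.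
pose M j := mean (fun s => f (lift_perm ord0 j s)).
have n0 : 0 < N.+1%:R :> R by rewrite ltr0n.
have Mf : \sum_j (M j - mean f) = 0.
  rewrite sumrB sumr_const card_ord -[mean f *+ _]mulr_natr
    [mean f]mean_lift_perm -/M.
  by rewrite divfK ?subrr // gt_eqF.
have Mc j : `|M j - mean f| <= c.
  have -> : M j - mean f = (\sum_k (M j - M k)) / N.+1%:R.
    rewrite sumrB sumr_const card_ord mulrBl -[M j *+ _]mulr_natr mulfK
      ?gt_eqF //.
    by rewrite [mean f]mean_lift_perm.
  rewrite normrM normfV (gtr0_norm n0) ler_pdivrMr //.
  apply: le_trans (ler_norm_sum _ _ _) _.
  rewrite mulr_natr -[X in _ <= _ *+ X](card_ord N.+1) -sumr_const.
  by apply: ler_sum => k _; apply: mean_lift_close.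
have q0 : 0 <= 1 + 2 * (t * c) ^+ 2 :> R by have := sqr_ge0 (t * c); lra.
rewrite mean_lift_perm ler_pdivrMr // exprS.
apply: (@le_trans _ _
  (\sum_j expR (t * (M j - mean f)) * (1 + 2 * (t * c) ^+ 2) ^+ N)).
  apply: ler_sum => j _.
  have -> : (fun s => expR (t * (f (lift_perm ord0 j s) - mean f))) =
     (fun s => expR (t * (M j - mean f)) * expR
       (t * (f (lift_perm ord0 j s) - M j))).
    by apply: funext => s; rewrite -expRD; congr expR; ring.
  rewrite meanZ ler_wpM2l ?expR_ge0 //.
  exact: IH (lift_perm_lipschitz j fc).
rewrite -mulr_suml mulrAC ler_wpM2r ?exprn_ge0 //.
apply: (@le_trans _ _
  (\sum_(j < N.+1) (1 + t * (M j - mean f) + 2 * (t * c) ^+ 2))).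
  apply: ler_sum => j _; have := Mc j; rewrite ler_norml => /andP[h1 h2].
  apply: le_trans (expR_le_quad _) _.
    by apply: le_trans tc; rewrite ler_wpM2l.
  rewrite lerD2l ler_pM2l // -[leLHS]real_normK ?num_real // ?lerXn2r
    ?nnegrE //.
    by rewrite mulr_ge0 // (le_trans _ (Mc j)).
  by rewrite normrM ger0_norm // ler_wpM2l.
rewrite !big_split /= -mulr_sumr Mf mulr0 addr0 !sumr_const card_ord.
by rewrite -mulrnDl mulr_natr.
Qed.

(** Markov inequality for the exponential moment. *)
Lemma upper_tail (R : realType) N (f : 'S_N -> R) c t e :
  swap_lipschitz c f -> 0 <= t -> t * c <= 2^-1 ->
  #|[pred s | e <= f s - mean f]|%:R
    <= N`!%:R * ((1 + 2 * (t * c) ^+ 2) ^+ N * expR (- (t * e))).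
Proof.
move=> fc t0 tc.
have f0 : 0 < N`!%:R :> R by rewrite ltr0n fact_gt0.
apply: (@le_trans _ _ (\sum_s expR (t * (f s - mean f)) * expR (- (t * e)))).
  rewrite -sum1_card natr_sum big_mkcond; apply: ler_sum => s _; rewrite inE.
  case: ifP => [h|_]; last by rewrite mulr_ge0 ?expR_ge0.
  rewrite -expRD; apply: le_trans (expR_ge1Dx _).
  by rewrite -mulrBr lerDl mulr_ge0 // subr_ge0.
rewrite -mulr_suml mulrA ler_wpM2r ?expR_ge0 //.
by have := mean_expR fc t0 tc; rewrite /mean ler_pdivrMr // [leRHS]mulrC.
Qed.

(** When [c] is of order [1 / N] the exponential moment with [t = u N] is at
    most [expR (2 u^2 K^2 N)], so the tail decays exponentially once [u] is
    small compared with [e / K^2]. *)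
Lemma concentration (R : realType) (K e : R) : 0 < K -> 0 < e ->
  exists2 q : R, 0 < q < 1 & forall N c (f : 'S_N -> R),
    swap_lipschitz c f -> c * N%:R <= K ->
    #|[pred s | e <= `|f s - mean f|]|%:R <= N`!%:R * (2 * q ^+ N).
Proof.
move=> K0 e0; pose u := e / (4 * K ^+ 2 + 2 * K * e).
have d0 : 0 < 4 * K ^+ 2 + 2 * K * e.
  by rewrite addr_gt0 // ?mulr_gt0 // exprn_gt0.
(* This choice of u gives both u K <= 1/2 and 2 u K^2 <= e / 2. *)
have u0 : 0 < u by rewrite divr_gt0.
have uK : u * K <= 2^-1.
  rewrite /u mulrAC ler_pdivrMr //; have := sqr_ge0 K; lra.
have uK2 : 2 * (u * K ^+ 2) <= e / 2.
  rewrite /u mulrAC mulrA ler_pdivrMr //.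
  have : 0 <= K * e ^+ 2 by rewrite mulr_ge0 ?sqr_ge0 // ltW.
  by rewrite -subr_ge0 => h; rewrite -subr_ge0; move: h; congr (0 <= _); field.
exists (expR (- (u * e / 2))) => [|N c f fc cN].
  by rewrite expR_gt0 expR_lt1 oppr_lt0 divr_gt0 // mulr_gt0.
pose t := u * N%:R.
have t0 : 0 <= t by rewrite mulr_ge0 // ltW.
have tcK : t * c <= u * K by rewrite /t -mulrA ler_wpM2l // ?(ltW u0) // mulrC.
have tc := le_trans tcK uK.
have tc0 : 0 <= t * c.
  case: (posnP N) => [N0|N0]; first by rewrite /t N0 mulr0 mul0r.
  pose i := Ordinal N0; apply: mulr_ge0 => //.
  by apply: le_trans (fc 1%g i i).
have bound (g : 'S_N -> R) : swap_lipschitz c g ->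
    #|[pred s | e <= g s - mean g]|%:R <= N`!%:R * expR (- (u * e / 2)) ^+ N.
  move=> gc; apply: le_trans (upper_tail e gc t0 tc) _.
  rewrite ler_wpM2l ?ler0n //.
  apply: (@le_trans _ _ (expR (2 * (u * K) ^+ 2) ^+ N * expR (- (u * e)) ^+ N)).
    rewrite -[X in _ <= _ * X]expRM_natl; apply: ler_pM; rewrite ?expR_ge0 //.
    - by rewrite exprn_ge0 // addr_ge0 // mulr_ge0 // sqr_ge0.
    - apply: lerXn2r; rewrite ?nnegrE ?expR_ge0 //.
        by rewrite addr_ge0 // mulr_ge0 // sqr_ge0.
      apply: le_trans (expR_ge1Dx _); rewrite lerD2l ler_pM2l //.
      by apply: lerXn2r; rewrite ?nnegrE // mulr_ge0 // ltW.
    by rewrite ler_expR /t;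
      have -> : N%:R * - (u * e) = - (u * N%:R * e) by ring.
  rewrite -exprMn; apply: lerXn2r; rewrite ?nnegrE ?mulr_ge0 ?expR_ge0 //.
  rewrite -expRD ler_expR.
  have : u * (2 * (u * K ^+ 2)) <= u * (e / 2) by rewrite ler_pM2l.
  by rewrite exprMn; lra.
have fNc : swap_lipschitz c (fun s => - f s).
  by move=> s a b; rewrite -opprD normrN; apply: fc.
have meanN : mean (fun s => - f s) = - mean f by rewrite /mean sumrN mulNr.
have -> : N`!%:R * (2 * expR (- (u * e / 2)) ^+ N)
    = N`!%:R * expR (- (u * e / 2)) ^+ N + N`!%:R * expR (- (u * e / 2)) ^+ N.
  by rewrite -mulrDr mulr2n mulrDl mul1r.
apply: le_trans (lerD (bound _ fc) (bound _ fNc)).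
rewrite -natrD ler_nat -cardUI; apply: leq_trans (leq_addr _ _).
apply/subset_leq_card/fintype.subsetP => s; rewrite !inE meanN => h.
by move: h; rewrite ler_normr => /orP[] h; apply/orP; [left|right; lra].
Qed.

Local Open Scope classical_set_scope.
Local Open Scope ring_scope.

(** * Almost sure convergence *)

Lemma uniform_perm_event (R : realType) d (Omega : measurableType d)
    (P : probability Omega R) l (la : Omega -> 'S_l) (D : {pred 'S_l}) :
  uniform_perm P la ->
  measurable (la @^-1` [set s | s \in D]) /\
  (P (la @^-1` [set s | s \in D]) <= (#|D|%:R / l`!%:R)%:E)%E.
Proof.
move=> unif.
have -> : la @^-1` [set s | s \in D] =
  \big[setU/set0]_(s <- enum D) (la @^-1` [set s]).
  rewrite -bigcup_seq; apply/seteqP; split => w /=.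
    by move=> wD; exists (la w); rewrite /= ?mem_enum.
  by case=> s /=; rewrite mem_enum => sD ->.
split; first by apply: bigsetU_measurable => s _; have [] := unif s.
rewrite cardE; elim: (enum D) => [|s r IH].
  by rewrite big_nil measure0 /= mul0r.
have mr : measurable (\big[setU/set0]_(s <- r) (la @^-1` [set s])).
  by apply: bigsetU_measurable => t _; have [] := unif t.
have [ms Ps] := unif s.
rewrite big_cons.
set A := la @^-1` [set s] in ms Ps *; set B := \big[_/_]_(_ <- r) _ in mr IH *.
have PU : (P (A `|` B) <= P A + P B)%E by exact: measureU2.
have -> : ((size (s :: r))%:R / l`!%:R)%:E
    = ((l`!%:R^-1)%:E + ((size r)%:R / l`!%:R)%:E)%E :> \bar R.
  by rewrite -EFinD /= -natr1 mulrDl mul1r addrC.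
by apply: (le_trans PU); rewrite Ps; apply: leeD2l.
Qed.

(** The first Borel-Cantelli lemma, with summability given by a bound on the
    partial sums. *)
Lemma borel_cantelli_ae (R : realType) d (Omega : measurableType d)
    (P : probability Omega R) (F : nat -> set Omega) (B : R) :
  (forall l, measurable (F l)) ->
  (forall n, (\sum_(0 <= l < n) P (F l) <= B%:E)%E) ->
  {ae P, forall w, \forall l \near \oo, ~ F l w}.
Proof.
move=> mF sumF; exists (lim_sup_set F); split.
- by apply: bigcap_measurable => // k _; apply: bigcup_measurable.
- apply: lim_sup_set_cvg0 => //; apply: le_lt_trans (ltry B).
  by apply: lime_le; [apply: is_cvg_nneseries | apply: nearW].
move=> w /= nw n _; apply: contrapT => none; apply: nw;
  exists n => // l /= nl Fl.
by apply: none; exists l.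
Qed.

(** Only the law of each [la l] enters the Borel-Cantelli lemma, so the
    coupling is arbitrary. *)
Lemma almost_sure_concentration (R : realType) d (Omega : measurableType d)
    (P : probability Omega R) (la : forall l, Omega -> 'S_l.+1)
    (f : forall l, 'S_l.+1 -> R) (K : R) : 0 < K ->
  (forall l, swap_lipschitz (K / l.+1%:R) (f l)) ->
  (forall l, uniform_perm P (la l)) ->
  {ae P, forall w, f l (la l w) - mean (f l) @[l --> \oo] --> (0 : R)}.
Proof.
move=> K0 fl unif.
have dev (k : nat) : {ae P, forall w, \forall l \near \oo,
    ~ (k.+1%:R^-1 <= `|f l (la l w) - mean (f l)|)}.
  have k0 : 0 < k.+1%:R^-1 :> R by rewrite invr_gt0 ltr0n.
  have [q /andP[q0 q1] conc] := concentration K0 k0.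
  pose D l := [pred s | k.+1%:R^-1 <= `|f l s - mean (f l)|].
  pose F l := la l @^-1` [set s | s \in D l].
  apply: (@borel_cantelli_ae _ _ _ _ F (2 * q * (1 - q)^-1)) => [l|n].
    by have [] := uniform_perm_event (D l) (unif l).
  apply: (@le_trans _ _ (series (geometric (2 * q) q) n)%:E); last first.
    rewrite lee_fin; apply: geometric_le_lim => //.
      by rewrite mulr_ge0 // ltW.
    by rewrite ger0_norm // ltW.
  rewrite /series /= -sumEFin; apply: lee_sum => l _.
  have [_ le] := uniform_perm_event (D l) (unif l); apply: le_trans le _.
  rewrite lee_fin ler_pdivrMr ?ltr0n ?fact_gt0 //= -[2 * q * _]mulrA -exprS
    mulrC.
  by apply: conc (fl l) _; rewrite divfK // pnatr_eq0.
have := ae_foralln dev; apply: filterS => w small; apply/cvgrPdist_lt => e e0.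
have [k ke] : exists k : nat, k.+1%:R^-1 < e.
  by have [k _ /(_ k (leqnn k))] := near_infty_natSinv_lt (PosNum e0); exists k.
apply: filterS (small k) => l /negP; rewrite -ltNge sub0r normrN => lt.
exact: lt_trans lt ke.
Qed.

(** * Limit densities of a random inflation *)

Definition increasing_count n m (b : {ffun 'I_m -> 'I_n}) : nat :=
  #|[pred a : 'S_m | agrees (lexlt (fun i => b i) (fun i => a i)) 1%g]|.

Definition pattern_count n m (tau : 'S_n) (pi : 'S_m)
    (b : {ffun 'I_m -> 'I_n}) : nat :=
  #|[pred a : 'S_m | agrees (lexlt (fun i => tau (b i)) (fun i => a i)) pi]|.

(** Divided by [m!^2 n^m], the limit probability that a random word of [m]
    points is increasing and has pattern [pi]. *)
Definition inflation_weight n m (tau : 'S_n) (pi : 'S_m) : nat :=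
  \sum_(b : {ffun 'I_m -> 'I_n}) increasing_count b * pattern_count tau pi b.

Lemma card_natsum (T : finType) (A : {pred T}) : #|A| = (\sum_x (x \in A))%N.
Proof. by rewrite -sum1_card big_mkcond; apply: eq_bigr => x _;
  case: (x \in A). Qed.

(** Distribute the product over the letters of the sum over words. *)
Lemma card_ffun_at l m (i : 'I_m) (J : {pred 'I_l}) :
  #|[pred o : {ffun 'I_m -> 'I_l} | o i \in J]| = (#|J| * l ^ m.-1)%N.
Proof.
(* The indicator of the condition imposed on the letter at place k. *)
pose F (k : 'I_m) (x : 'I_l) : nat := (k != i) || (x \in J).
transitivity (\sum_(o : {ffun 'I_m -> 'I_l}) \prod_k F k (o k))%N.
  rewrite card_natsum; apply: eq_bigr => o _; rewrite inE (bigD1 i) //=.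
  rewrite big1 => [|k /negbTE ki]; last by rewrite /F ki.
  by rewrite /F eqxx muln1.
rewrite -bigA_distr_bigA (bigD1 i) //=; congr (_ * _)%N.
  rewrite card_natsum; apply: eq_bigr => x _.
  by rewrite /F eqxx.
rewrite (eq_bigr (fun=> l)) => [|k ki]; last first.
  by rewrite /F ki sum_nat_const card_ord muln1.
by rewrite prod_nat_const cardC1 card_ord.
Qed.

(** Exchanging the values [x] and [y] of [la] only affects the words with an
    offset at one of the two positions where these values are taken. *)
Lemma tensor_count_swap n l m (tau : 'S_n) (pi : 'S_m) (la : 'S_l) x y :
  (tensor_count tau pi (la * tperm x y)%g <=
   tensor_count tau pi la + n ^ m * (m * (2 * l ^ m.-1)))%N.
Proof.
have -> : (n ^ m * (m * (2 * l ^ m.-1)) =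
    \sum_(b : {ffun 'I_m -> 'I_n}) m * (2 * l ^ m.-1))%N.
  by rewrite sum_nat_const card_ffun !card_ord.
rewrite -big_split; apply: leq_sum => b _.
pose J := (la @^-1: [set x; y])%SET.
apply: (@leq_trans (\sum_(o : {ffun 'I_m -> 'I_l})
    (fits tau la pi b o + \sum_i (o i \in J)))).
  rewrite card_natsum; apply: leq_sum => o _; rewrite inE.
  have [/existsP[i hit]|/existsPn miss] := boolP [exists i, o i \in J].
    by rewrite (bigD1 i) //= hit addnCA; case: fits.
  suff -> : fits tau (la * tperm x y)%g pi b o = fits tau la pi b o.
    by rewrite leq_addr.
  rewrite /fits; congr (_ && _); apply: eq_agrees => i j; rewrite /lexlt !permM.
  have tp k : tperm x y (la (o k)) = la (o k).
    have := miss k; rewrite !inE negb_or => /andP[nx ny].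
    by rewrite tpermD // eq_sym.
  by rewrite !tp.
rewrite big_split exchange_big /= leq_add //.
  by rewrite card_natsum; apply: leq_sum => o _; rewrite inE.
rewrite -[X in (_ <= X * _)%N]card_ord -sum_nat_const; apply: leq_sum => i _.
have <- : #|[pred o : {ffun 'I_m -> 'I_l} | o i \in J]|
    = (\sum_(o : {ffun 'I_m -> 'I_l}) (o i \in J))%N.
  by rewrite card_natsum; apply: eq_bigr => o _; rewrite inE.
rewrite card_ffun_at leq_mul2r card_preimset ?cards2; last exact: perm_inj.
by case: (_ != _); rewrite orbT.
Qed.

(** Words with injective offsets are counted exactly by equidistribution, for
    the order of [o] and, given [o], for that of [la o]. The remainder [r]
    collects the words with a repeated offset. *)
Lemma sum_tensor_count n l m (tau : 'S_n) (pi : 'S_m) :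
  exists2 r : nat, (r <= l`! * (n ^ m * (l ^ m - l ^_ m)))%N &
  (m`! * m`! * \sum_(la : 'S_l) tensor_count tau pi la =
    l`! * (l ^_ m * inflation_weight tau pi) + m`! * m`! * r)%N.
Proof.
pose inc (b : {ffun 'I_m -> 'I_n}) (o : {ffun 'I_m -> 'I_l}) :=
  agrees (lexlt (fun i => b i) (fun i => o i)) 1%g.
pose good (b : {ffun 'I_m -> 'I_n}) (o : {ffun 'I_m -> 'I_l}) :=
  #|[pred la : 'S_l | agrees (lexlt (fun i => tau (b i)) (fun i => la (o i)))
    pi]|.
exists (\sum_(b : {ffun 'I_m -> 'I_n})
  \sum_(o : {ffun 'I_m -> 'I_l} | ~~ injectiveb o) inc b o * good b o)%N.
  have cardF a : (a ^ m)%N = #|{: {ffun 'I_m -> 'I_a}}|.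
    by rewrite card_ffun !card_ord.
  rewrite mulnCA cardF -sum_nat_const; apply: leq_sum => b _.
  have -> : (l ^ m - l ^_ m)%N =
    #|[pred o : {ffun 'I_m -> 'I_l} | ~~ injectiveb o]|.
    rewrite cardF -(cardC (fun o : {ffun 'I_m -> 'I_l} => injectiveb o)).
    have -> : l ^_ m = #|[set f : {ffun 'I_m -> 'I_l} | injectiveb f]%SET|.
      by rewrite card_inj_ffuns !card_ord.
    by rewrite cardsE addKn; apply: eq_card => o; rewrite !inE.
  rewrite mulnC -sum_nat_const.
  apply: leq_sum => o _; rewrite -[l`!]mul1n leq_mul ?leq_b1 //.
  by rewrite -card_Sn max_card.
have -> : (\sum_(la : 'S_l) tensor_count tau pi la =
    \sum_(b : {ffun 'I_m -> 'I_n}) \sum_o inc b o * good b o)%N.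
  rewrite exchange_big; apply: eq_bigr => b _.
  transitivity (\sum_(la : 'S_l) \sum_o (fits tau la pi b o : nat))%N.
    by apply: eq_bigr => la _; rewrite card_natsum; apply: eq_bigr => o _;
      rewrite inE.
  rewrite exchange_big; apply: eq_bigr => o _.
  rewrite /good card_natsum big_distrr; apply: eq_bigr => la _.
  by rewrite inE /fits -/(inc b o); case: (inc b o); case: agrees.
rewrite /inflation_weight !big_distrr -big_split; apply: eq_bigr => b _ /=.
rewrite (bigID (fun o : {ffun 'I_m -> 'I_l} => injectiveb o)) mulnDr;
  congr (_ + _)%N.
have -> : (m`! * m`! * \sum_(o : {ffun 'I_m -> 'I_l} | injectiveb o) inc b o *
  good b o =
   m`! * \sum_(o : {ffun 'I_m -> 'I_l} | injectiveb o) inc b o *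
     (l`! * pattern_count tau pi b))%N.
  rewrite -mulnA; congr (_ * _)%N; rewrite big_distrr;
    apply: eq_bigr => o /injectiveP oi.
  rewrite [LHS]mulnCA; congr (_ * _)%N.
  rewrite /pattern_count
    -(card_perm_standardization
    [pred a : 'S_m | agrees (lexlt (fun i => tau (b i)) (fun i => a i)) pi] oi);
    congr (_ * _)%N; apply: eq_card => la; rewrite !inE.
  by rewrite -agrees_lexlt_standardization // => i j /val_inj/perm_inj/oi.
rewrite -big_distrl.
have -> : (\sum_(o : {ffun 'I_m -> 'I_l} | injectiveb o) inc b o =
  #|[pred o : {ffun 'I_m -> 'I_l} | injectiveb o &&
    (standardization (fun i => o i) \in
    [pred a : 'S_m | agrees (lexlt (fun i => b i) (fun i => a i)) 1%g])]|)%N.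
  rewrite card_natsum big_mkcond; apply: eq_bigr => o _; rewrite inE.
  case: injectiveP => //= oi;
    rewrite inE -agrees_lexlt_standardization // => i j /val_inj/oi //.
have := card_inj_standardization l
  [pred a : 'S_m | agrees (lexlt (fun i => b i) (fun i => a i)) 1%g].
rewrite -/(increasing_count b) => e.
by rewrite [LHS]mulnA e; ring.
Qed.

(** The count is normalised by the number of all words rather than by the
    binomial coefficient: a word has a given letter at a given place with
    probability exactly [1 / (n * l)]. *)
Definition pattern_frequency (R : realType) n m (tau : 'S_n) (pi : 'S_m) l
    (la : 'S_l) : R :=
  (tensor_count tau pi la)%:R / ((n * l) ^ m)%:R.

Lemma pattern_frequency_lipschitz (R : realType) n m (tau : 'S_n) (pi : 'S_m)
    l :
  (0 < n)%N -> (0 < m)%N -> (0 < l)%N ->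
  swap_lipschitz ((2 * m)%:R / l%:R : R) (@pattern_frequency R n m tau pi l).
Proof.
move=> n0 m0 l0 la x y.
have N0 : 0 < ((n * l) ^ m)%:R :> R by rewrite ltr0n expn_gt0 muln_gt0 n0 l0.
have one_sided (s t : 'S_l) : t = (s * tperm x y)%g ->
    pattern_frequency R tau pi t - pattern_frequency R tau pi s <= (2 * m)%:R /
      l%:R.
  move=> ->; rewrite /pattern_frequency -mulrBl ler_pdivrMr // lerBlDl.
  have -> : (2 * m)%:R / l%:R * ((n * l) ^ m)%:R =
    (n ^ m * (m * (2 * l ^ m.-1)))%:R :> R.
    rewrite expnMn -{3}(prednK m0) expnS !natrM; field.
    by rewrite pnatr_eq0 -lt0n.
  by rewrite -natrD ler_nat tensor_count_swap.
rewrite ler_norml; apply/andP; split; last exact: one_sided.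
rewrite lerNl opprB; apply: one_sided.
by rewrite -mulgA tperm2 mulg1.
Qed.

(** Almost all words of fixed length over a large alphabet are injective. *)
Lemma ffact_expn_cvg (R : realType) (u : nat -> nat) m :
    (forall l, (l < u l)%N) ->
  ((u l) ^_ m)%:R / ((u l) ^ m)%:R @[l --> \oo] --> (1 : R).
Proof.
move=> ul; have u0 l : 0 < (u l)%:R :> R.
  by rewrite ltr0n (leq_ltn_trans _ (ul l)).
elim: m => [|m IH].
  rewrite (_ : (fun _ => _) = (fun=> 1)) ?divr1; first exact: cvg_cst.
  by apply: funext => l; rewrite ffactn0 expn0 divr1.
rewrite (_ : (fun _ => _) =
    (fun l => ((u l) ^_ m)%:R / ((u l) ^ m)%:R * ((u l - m)%:R / (u l)%:R)));
      last first.
  by apply: funext => l; rewrite ffactnSr expnSr !natrM invfM mulrACA.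
rewrite -[X in _ --> X]mulr1; apply: cvgM => //.
apply: (@squeeze_cvgr _ _ _ _ (fun l => 1 - m%:R * harmonic l) (fun=> 1)).
- apply: nearW => l; apply/andP; split; last first.
    by rewrite ler_pdivrMr // mul1r ler_nat leq_subr.
  apply: (@le_trans _ _ (1 - m%:R / (u l)%:R)).
    rewrite lerD2l lerN2 ler_wpM2l ?ler0n // /harmonic lef_pV2 ?posrE ?ltr0n //.
      by rewrite ler_nat.
    exact: leq_ltn_trans (ul l).
  rewrite ler_pdivlMr // mulrBl mul1r divfK ?gt_eqF //.
  by rewrite lerBlDr -natrD ler_nat addnC -leq_subLR.
- rewrite -[X in _ --> X]subr0 -[X in _ - X](mulr0 m%:R).
  by apply: cvgB; [exact: cvg_cst|apply: cvgM;
    [exact: cvg_cst|exact: cvg_harmonic]].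
exact: cvg_cst.
Qed.

Lemma ffact_le_expn l m : (l ^_ m <= l ^ m)%N.
Proof. by elim: m => // m IH; rewrite ffactnSr expnSr leq_mul // leq_subr. Qed.

(** With [r l] the proportion of injective words of offsets, the mean lies
    between [r l * W / (m!^2 n^m)] and the same plus [1 - r l]. *)
Lemma mean_pattern_frequency_cvg (R : realType) n m (tau : 'S_n) (pi : 'S_m) :
    (0 < n)%N ->
  mean (@pattern_frequency R n m tau pi l.+1) @[l --> \oo] -->
    ((inflation_weight tau pi)%:R / (m`! * m`! * n ^ m)%:R : R).
Proof.
move=> n0; set W := inflation_weight tau pi.
pose r l : R := (l.+1 ^_ m)%:R / (l.+1 ^ m)%:R.
have r1 : r l @[l --> \oo] --> (1 : R) by apply: ffact_expn_cvg.
have bounds l : r l * (W%:R / (m`! * m`! * n ^ m)%:R)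
    <= mean (@pattern_frequency R n m tau pi l.+1)
    <= r l * (W%:R / (m`! * m`! * n ^ m)%:R) + (1 - r l).
  have [e eb sum_eq] := sum_tensor_count l.+1 tau pi.
  have f0 k : k`!%:R != 0 :> R by rewrite pnatr_eq0 -lt0n fact_gt0.
  have Fpos := fact_gt0 l.+1; have F0 := f0 l.+1.
  rewrite /mean; move: (l.+1)`! => F in eb sum_eq F0 Fpos *.
  have n0' : n%:R != 0 :> R by rewrite pnatr_eq0 -lt0n.
  have l0 : l.+1%:R != 0 :> R by rewrite pnatr_eq0.
  have -> : (\sum_s @pattern_frequency R n m tau pi l.+1 s) / F%:R =
    r l * (W%:R / (m`! * m`! * n ^ m)%:R)
       + e%:R / (F * (n ^ m * l.+1 ^ m))%:R.
    have := congr1 (fun k : nat => k%:R : R) sum_eq.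
    rewrite !natrD !natrM natr_sum => sumR.
    rewrite /pattern_frequency -mulr_suml expnMn !natrM !natrX.
    set S := \sum_s _ in sumR *.
    have -> : S = (F%:R * ((l.+1 ^_ m)%:R * W%:R) + m`!%:R * m`!%:R * e%:R) /
      (m`!%:R * m`!%:R).
      by rewrite -sumR mulrAC mulfV ?mul1r // mulf_neq0.
    rewrite /r natrX; field.
    by rewrite !expf_neq0 // !f0 F0.
  rewrite lerDl divr_ge0 ?ler0n //= lerD2l.
  rewrite ler_pdivrMr ?ltr0n ?muln_gt0 ?Fpos ?expn_gt0 ?n0 //.
  have -> : 1 - r l = (l.+1 ^ m - l.+1 ^_ m)%:R / (l.+1 ^ m)%:R.
    by rewrite /r natrB ?ffact_le_expn // mulrBl divff // pnatr_eq0 expn_eq0.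
  rewrite mulrAC ler_pdivlMr ?ltr0n ?expn_gt0 // -!natrM ler_nat.
  apply: leq_trans (leq_mul eb (leqnn _)) _.
  move: (l.+1 ^ m - _)%N => gap; apply: eq_leq; ring.
apply: (squeeze_cvgr (nearW _ bounds)).
  rewrite -[X in _ --> X]mul1r.
  by apply: cvgM => //; apply: cvg_cst.
rewrite -[X in _ --> X]addr0 -[X in _ --> X + _]mul1r -[X in _ + X](subrr 1).
apply: cvgD; first by apply: cvgM => //; apply: cvg_cst.
by apply: cvgB => //; apply: cvg_cst.
Qed.

(** The frequency has the limit of its means, and the ratio of [(n l)^m] to the
    number of [m]-subsets tends to [m!]. *)
Lemma density_cvg_ae (R : realType) n m (tau : 'S_n) (pi : 'S_m)
    d (Omega : measurableType d) (P : probability Omega R)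
    (la : forall l, Omega -> 'S_l.+1) :
  (0 < n)%N -> (0 < m)%N -> (forall l, uniform_perm P (la l)) ->
  {ae P, forall w, density R pi (tensor tau (la l w)) @[l --> \oo] -->
    ((inflation_weight tau pi)%:R / (m`! * n ^ m)%:R : R)}.
Proof.
move=> n0 m0 unif.
have K0 : 0 < (2 * m)%:R :> R by rewrite ltr0n muln_gt0.
have lip l := @pattern_frequency_lipschitz R n m tau pi l.+1 n0 m0 (ltn0Sn l).
apply: filterS (almost_sure_concentration K0 lip unif) => w dev.
have frequency_cvg : pattern_frequency R tau pi (la l w) @[l --> \oo] -->
    ((inflation_weight tau pi)%:R / (m`! * m`! * n ^ m)%:R : R).
  rewrite -[X in _ --> X]add0r (_ : (fun l => _) = (fun l =>
    (pattern_frequency R tau pi (la l w)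
     - mean (@pattern_frequency R n m tau pi l.+1)) 
     + mean (@pattern_frequency R n m tau pi l.+1))).
    exact: cvgD dev (@mean_pattern_frequency_cvg R n m tau pi n0).
  by apply: funext => l; rewrite subrK.
have f0 : m`!%:R != 0 :> R by rewrite pnatr_eq0 -lt0n fact_gt0.
have n0' : n%:R != 0 :> R by rewrite pnatr_eq0 -lt0n.
have ratio : m`!%:R * (((n * l.+1) ^_ m)%:R / ((n * l.+1) ^ m)%:R)^-1
  @[l --> \oo]
    --> (m`!%:R * 1^-1 : R).
  apply: cvgM; first exact: cvg_cst.
  apply: cvgV; first exact: oner_neq0.
  by apply: (ffact_expn_cvg (u := fun l => n * l.+1)%N) => l; rewrite leq_pmull.
have <- : (inflation_weight tau pi)%:R / (m`! * m`! * n ^ m)%:R *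
  (m`!%:R * 1^-1)
    = (inflation_weight tau pi)%:R / (m`! * n ^ m)%:R :> R.
  by rewrite !natrM natrX; field; rewrite f0 expf_neq0.
rewrite (_ : (fun l => _) = (fun l => pattern_frequency R tau pi (la l w)
    * (m`!%:R * (((n * l.+1) ^_ m)%:R / ((n * l.+1) ^ m)%:R)^-1))).
  exact: cvgM frequency_cvg ratio.
apply: funext => l; rewrite densityE /pattern_frequency -bin_ffact natrM.
have N0 : ((n * l.+1) ^ m)%:R != 0 :> R.
  by rewrite pnatr_eq0 -lt0n expn_gt0 muln_gt0 n0.
move: ('C(_, m)%:R : R) (((n * l.+1) ^ m)%:R : R) N0 => C N N0.
have [->|C0] := eqVneq C 0; first by rewrite !(mul0r, invr0, mulr0).
by field; rewrite ?N0 ?C0 ?f0.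
Qed.

(** * A coupling of uniform permutations *)

(** The half-open interval is a disjoint union of cells of equal length. *)
Definition unit_prob (R : realType) : set (measurableTypeR R) -> \bar R :=
  mrestr (@lebesgue_measure R) (measurable_itv `[0%R, 1%R[).

HB.instance Definition _ (R : realType) := Measure.on (@unit_prob R).

Lemma unit_prob_setT (R : realType) : @unit_prob R setT = 1%E.
Proof.
by rewrite /unit_prob /mrestr setTI lebesgue_measure_itv /= lte_fin ltr01 -EFinB
  subr0.
Qed.

HB.instance Definition _ (R : realType) :=
  Measure_isProbability.Build _ _ R (@unit_prob R) (@unit_prob_setT R).

(** The unit interval is cut into [l!] cells of equal length, one for each
    permutation. *)
Definition unit_perm (R : realType) l (x : measurableTypeR R) : 'S_l :=
  nth 1%g (enum 'S_l) (Num.truncn ((x : R) * l`!%:R)).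

(** Restricted to the unit interval, the preimage of the [k]-th permutation is
    the cell from [k / l!] to [(k + 1) / l!]. Outside it, measurability holds
    because [unit_perm] factors through the integer part. *)
Lemma unit_perm_uniform (R : realType) l :
    uniform_perm (@unit_prob R) (@unit_perm R l).
Proof.
move=> s; pose F : R := l`!%:R.
have F0 : 0 < F by rewrite ltr0n fact_gt0.
split.
  pose T (j : nat) : set R := [set x | Num.truncn (x * F) = j].
  have -> : @unit_perm R l @^-1` [set s] =
      \bigcup_(j in [set j | nth 1%g (enum 'S_l) j = s]) T j.
    apply/seteqP; split => x /=; last by case=> j /= js;
      rewrite /T /unit_perm /= => ->.
    by move=> xs; exists (Num.truncn (x * F)).
  apply: bigcup_measurable => j _.
  (* The points whose integer part after scaling is at most i. *)
  pose L (i : nat) : set R := `]-oo, (i.+1%:R / F)[%classic.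
  have inL i x : L i x <-> (Num.truncn (x * F) <= i)%N.
    by rewrite /L /= in_itv /= truncn_le_nat ltr_pdivlMr.
  have mL i : measurable (L i : set (measurableTypeR R)).
    exact: measurable_itv.
  case: j => [|j].
    rewrite (_ : T 0%N = L 0%N) //; apply/seteqP; split => x.
      by rewrite /T /= => x0; apply/inL; rewrite x0.
    by move=> /inL; rewrite leqn0 => /eqP.
  rewrite (_ : T j.+1 = L j.+1 `\` L j); first exact: measurableD.
  apply/seteqP; split => x; rewrite /T /=.
    by move=> xj; split; [apply/inL; rewrite xj|move/inL; rewrite xj ltnn].
  move=> [/inL le /inL/negP]; rewrite -ltnNge => lt.
  by apply/eqP; rewrite eqn_leq le.
pose k := index s (enum 'S_l).
have kl : (k < l`!)%N by rewrite -card_Sn cardE index_mem mem_enum.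
rewrite /= /unit_prob /mrestr.
have -> : @unit_perm R l @^-1` [set s] `&`
  `[0%R, 1%R[ = `[k%:R / F, k.+1%:R / F[%classic.
  apply/seteqP; split => x; rewrite /= !in_itv /= ler_pdivrMr // ltr_pdivlMr //.
    move=> [xs /andP[x0 x1]]; rewrite -truncn_eq;
      last by rewrite mulr_ge0 // ltW.
    rewrite /k -xs index_uniq ?enum_uniq // -cardE card_Sn truncn_lt_nat.
      by rewrite -[ltRHS]mul1r ltr_pM2r.
    by rewrite mulr_ge0 // ltW.
  move=> /andP[kx xk]; have x0 : 0 <= x * F by apply: le_trans kx.
  split; last first.
    rewrite -(pmulr_lge0 (x : R) F0) x0 /= -(ltr_pM2r F0) mul1r.
    by apply: lt_le_trans xk _; rewrite ler_nat.
  by rewrite /unit_perm (truncn_def (n := k)) ?kx // nth_index // mem_enum.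
rewrite lebesgue_measure_itv /= lte_fin ltr_pM2r ?invr_gt0 // ltr_nat ltnSn.
by rewrite -EFinB -mulrBl -natr1 addrAC subrr add0r mul1r.
Qed.

(** * Patterns of length three *)

Local Notation i0 := (@Ordinal 3 0 isT).
Local Notation i1 := (@Ordinal 3 1 isT).
Local Notation i2 := (@Ordinal 3 2 isT).

(** The three comparisons that determine a strict order on ['I_3]. *)
Definition cmp3 (r : rel 'I_3) : bool * bool * bool :=
    (r i0 i1, r i0 i2, r i1 i2).

Definition perm_cmp3 (a : 'S_3) := cmp3 (ltrel (fun i => a i)).

(** The comparisons of 123, 132, 213, 231, 312 and 321; the two missing triples
    are the cyclic ones. *)
Definition cmp3_values : seq (bool * bool * bool) :=
  [:: (true, true, true); (true, true, false); (false, true, true);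
      (true, false, false); (false, false, true); (false, false, false)].

Lemma ord3P (P : 'I_3 -> Prop) : P i0 -> P i1 -> P i2 -> forall i, P i.
Proof.
move=> h0 h1 h2 [[|[|[|//]]] lt].
- by rewrite (_ : Ordinal lt = i0) //; apply: val_inj.
- by rewrite (_ : Ordinal lt = i1) //; apply: val_inj.
by rewrite (_ : Ordinal lt = i2) //; apply: val_inj.
Qed.

Lemma agrees_cmp3 (r : rel 'I_3) (pi : 'S_3) : irreflexive r ->
  (forall i j, i != j -> r j i = ~~ r i j) ->
  agrees r pi = (cmp3 r == perm_cmp3 pi).
Proof.
move=> irr asym.
have neq i j : i != j -> (pi j < pi i)%N = ~~ (pi i < pi j)%N.
  move=> ij; rewrite -leqNgt ltn_neqAle;
    case: eqVneq => //= /val_inj/perm_inj ji.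
  by rewrite ji eqxx in ij.
apply/agreesP/eqP => [h|[h01 h02 h12]].
  by rewrite /perm_cmp3 /cmp3 /ltrel !h.
rewrite /ltrel in h01 h02 h12.
elim/ord3P; elim/ord3P; rewrite ?irr ?ltnn // ?h01 ?h02 ?h12 //.
- by rewrite asym // h01 -neq.
- by rewrite asym // h02 -neq.
by rewrite asym // h12 -neq.
Qed.

Lemma perm_cmp3_inj : injective perm_cmp3.
Proof.
move=> a b eab.
have ag (c : 'S_3) : agrees (ltrel (fun i => a i)) c =
  (perm_cmp3 a == perm_cmp3 c).
  apply: agrees_cmp3 => [i|i j ij]; rewrite /ltrel ?ltnn //.
  rewrite -leqNgt ltn_neqAle; case: eqVneq => //= /val_inj/perm_inj ji.
  by rewrite ji eqxx in ij.
by apply: (@agrees_inj _ (ltrel (fun i => a i))); rewrite ag ?eqxx ?eab.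
Qed.

Lemma perm_cmp3_in a : perm_cmp3 a \in cmp3_values.
Proof.
rewrite /perm_cmp3 /cmp3 /ltrel;
  move: (a i0 : nat) (a i1 : nat) (a i2 : nat) => x y z.
by case: (ltnP x y); case: (ltnP x z); case: (ltnP y z) => //; lia.
Qed.

(** An injection of the six permutations into six values is a bijection, so
    counting over ['S_3] becomes counting in a list. *)
Lemma perm_eq_cmp3_values :
    perm_eq [seq perm_cmp3 a | a <- enum 'S_3] cmp3_values.
Proof.
have u : uniq [seq perm_cmp3 a | a <- enum 'S_3].
  by rewrite map_inj_uniq ?enum_uniq //; exact: perm_cmp3_inj.
have sub : {subset [seq perm_cmp3 a | a <- enum 'S_3] <= cmp3_values}.
  by move=> t /mapP[a _ ->]; exact: perm_cmp3_in.
have sz : (size cmp3_values <= size [seq perm_cmp3 a | a <- enum 'S_3])%N.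
  by rewrite size_map -cardE card_Sn.
by have [_ eqs] := uniq_min_size u sub sz; apply: uniq_perm.
Qed.

Lemma card_perm_cmp3 (P : {pred bool * bool * bool}) :
  #|[pred a : 'S_3 | P (perm_cmp3 a)]| = count P cmp3_values.
Proof.
rewrite -(seq.permP perm_eq_cmp3_values) count_map cardE size_filter -enumT.
by apply: eq_count.
Qed.

Lemma perm_cmp3_onto t : t \in cmp3_values -> exists a : 'S_3, perm_cmp3 a = t.
Proof. by rewrite -(perm_mem perm_eq_cmp3_values) => /mapP[a _ ->];
  exists a. Qed.

(** The comparisons of the pairs [(x, _)], [(y, _)] and [(z, _)] when those of
    the second components are given by [t]. *)
Definition lex_cmp3 (x y z : nat) (t : bool * bool * bool) :
    bool * bool * bool :=
  ((x < y)%N || (x == y) && t.1.1, (x < z)%N || (x == z) && t.1.2,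
   (y < z)%N || (y == z) && t.2).

(** The number of orders of second components for which the lexicographic
    comparisons are [t]. *)
Definition lex_count (t : bool * bool * bool) (x y z : nat) : nat :=
  count (fun s => lex_cmp3 x y z s == t) cmp3_values.

Lemma card_lex_cmp3 (b : 'I_3 -> nat) (pi : 'S_3) :
  #|[pred a : 'S_3 | agrees (lexlt b (fun i => a i)) pi]|
  = lex_count (perm_cmp3 pi) (b i0) (b i1) (b i2).
Proof.
rewrite /lex_count -(card_perm_cmp3
  (fun s => lex_cmp3 (b i0) (b i1) (b i2) s == perm_cmp3 pi)).
apply: eq_card => a; rewrite !inE agrees_cmp3 // => [i|i j ij].
  by rewrite /lexlt !ltnn andbF.
have : a i != a j by rewrite (inj_eq perm_inj).
rewrite -(inj_eq val_inj) /lexlt /=.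
by case: (ltngtP (b i) (b j)) => //= _; case: (ltngtP (a i) (a j)).
Qed.

Lemma inflation_weight3_sumE n (tau : 'S_n) (pi : 'S_3) :
  inflation_weight tau pi = (\sum_(i < n) \sum_(j < n) \sum_(k < n)
    lex_count (true, true, true) i j k *
    lex_count (perm_cmp3 pi) (tau i) (tau j) (tau k))%N.
Proof.
rewrite /inflation_weight.
pose h (p : 'I_n * ('I_n * 'I_n)) : {ffun 'I_3 -> 'I_n} :=
  [ffun x => if x == i0 then p.1 else if x == i1 then p.2.1 else p.2.2].
rewrite (reindex h) /=; last first.
  exists (fun b => (b i0, (b i1, b i2))) => [[i [j k]] _|b _].
    by rewrite !ffunE.
  by apply/ffunP; elim/ord3P; rewrite !ffunE.
rewrite -(pair_bigA _
  (fun i p => increasing_count (h (i, p)) * pattern_count tau pi (h (i, p)))%N)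
  /=.
apply: eq_bigr => i _.
rewrite -(pair_bigA _
  (fun j k => increasing_count (h (i, (j, k))) * pattern_count tau pi
  (h (i, (j, k))))%N) /=.
apply: eq_bigr => j _; apply: eq_bigr => k _.
rewrite /increasing_count /pattern_count !card_lex_cmp3 !ffunE /=;
  congr (lex_count _ _ _ _ * _)%N.
by rewrite /perm_cmp3 /cmp3 /ltrel !perm1.
Qed.

Lemma lex_count_distinct t (x y z : nat) : x != y -> x != z -> y != z ->
  lex_count t x y z = (6 * (((x < y)%N, (x < z)%N, (y < z)%N) == t))%N.
Proof.
move=> /negbTE xy /negbTE xz /negbTE yz.
rewrite /lex_count /lex_cmp3 /= xy xz yz /= !orbF.
by case: (_ == t).
Qed.

Lemma lex_count_first t (x z : nat) : x != z ->
  lex_count t x x z = (3 * (((x < z)%N, (x < z)%N) == (t.1.2, t.2)))%N.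
Proof.
move=> /negbTE xz; rewrite /lex_count /lex_cmp3 /= xz ltnn eqxx /= !orbF.
by case: t => [[[] []] []]; case: (x < z)%N.
Qed.

Lemma lex_count_last t (x y : nat) : x != y ->
  lex_count t x y y = (3 * (((x < y)%N, (x < y)%N) == t.1))%N.
Proof.
move=> /negbTE xz; rewrite /lex_count /lex_cmp3 /= xz ltnn eqxx /= !orbF.
by case: t => [[[] []] []]; case: (x < y)%N.
Qed.

Lemma lex_count_all t (x : nat) : lex_count t x x x = (t \in cmp3_values).
Proof. by rewrite /lex_count /lex_cmp3 ltnn eqxx /=;
  case: t => [[[] []] []]. Qed.

Definition sum3 n (f : 'I_n -> 'I_n -> 'I_n -> nat) : nat :=
  \sum_(i < n) \sum_(j < n) \sum_(k < n) f i j k.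

Definition sum2 n (f : 'I_n -> 'I_n -> nat) : nat :=
    \sum_(i < n) \sum_(j < n) f i j.

Lemma eq_sum3 n (f g : 'I_n -> 'I_n -> 'I_n -> nat) :
  (forall i j k, f i j k = g i j k) -> sum3 f = sum3 g.
Proof.
by move=> e; apply: eq_bigr => i _; apply: eq_bigr => j _;
  apply: eq_bigr => k _.
Qed.

Lemma eq_sum2 n (f g : 'I_n -> 'I_n -> nat) :
  (forall i j, f i j = g i j) -> sum2 f = sum2 g.
Proof. by move=> e; apply: eq_bigr => i _; apply: eq_bigr => j _. Qed.

Lemma sum3D n (f g : 'I_n -> 'I_n -> 'I_n -> nat) :
  sum3 (fun i j k => f i j k + g i j k)%N = (sum3 f + sum3 g)%N.
Proof.
rewrite -big_split; apply: eq_bigr => i _; rewrite -big_split.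
by apply: eq_bigr => j _; rewrite -big_split.
Qed.

Lemma sum2D n (f g : 'I_n -> 'I_n -> nat) :
  sum2 (fun i j => f i j + g i j)%N = (sum2 f + sum2 g)%N.
Proof. by rewrite -big_split; apply: eq_bigr => i _; rewrite -big_split. Qed.

Lemma sum3M n c (f : 'I_n -> 'I_n -> 'I_n -> nat) :
  sum3 (fun i j k => c * f i j k)%N = (c * sum3 f)%N.
Proof.
rewrite [RHS]big_distrr; apply: eq_bigr => i _; rewrite [RHS]big_distrr.
by apply: eq_bigr => j _; rewrite [RHS]big_distrr.
Qed.

Lemma sum3_swap12 n (f : 'I_n -> 'I_n -> 'I_n -> nat) :
  sum3 (fun i j k => f j i k) = sum3 f.
Proof. by rewrite /sum3 exchange_big. Qed.

Lemma sum3_swap23 n (f : 'I_n -> 'I_n -> 'I_n -> nat) :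
  sum3 (fun i j k => f i k j) = sum3 f.
Proof. by apply: eq_bigr => i _; rewrite exchange_big. Qed.

Lemma sum_delta n (j : 'I_n) (F : 'I_n -> nat) :
    (\sum_(k < n) (j == k) * F k = F j)%N.
Proof.
rewrite (bigD1 j) //= eqxx mul1n big1 ?addn0 // => k.
by rewrite eq_sym => /negbTE ->.
Qed.

Lemma sum3_delta23 n (f : 'I_n -> 'I_n -> nat) :
  sum3 (fun i j k => (j == k) * f i j)%N = sum2 f.
Proof.
apply: eq_bigr => i _; apply: eq_bigr => j _.
by rewrite (sum_delta j (fun=> f i j)).
Qed.

Lemma sum3_delta12 n (f : 'I_n -> 'I_n -> nat) :
  sum3 (fun i j k => (i == j) * f i k)%N = sum2 f.
Proof.
apply: eq_bigr => i _; rewrite exchange_big; apply: eq_bigr => k _.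
by rewrite (sum_delta i (fun=> f i k)).
Qed.

Definition triple_count n (tau : 'S_n) (t : bool * bool * bool) : nat :=
  sum3 (fun i j k : 'I_n => (i < j)%N * (j < k)%N *
    (((tau i < tau j)%N, (tau i < tau k)%N, (tau j < tau k)%N) == t))%N.

(** When the first two points share a block, their comparisons [t.1.2] and
    [t.2] with the third point both agree with the comparison of the two
    blocks; when the last two points do, [t.1] takes this role. *)
Definition pair_count n (tau : 'S_n) (t : bool * bool * bool) : nat :=
  sum2 (fun i j : 'I_n => (i < j)%N *
    ((((tau i < tau j)%N, (tau i < tau j)%N) == (t.1.2, t.2)) +
     (((tau i < tau j)%N, (tau i < tau j)%N) == t.1)))%N.

(** The four terms are the words [i < j < k], [i = j < k], [i < j = k] and [i =
    j = k]; all other words are not increasing. *)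
Lemma lex_count_mul n (tau : 'S_n) (t : bool * bool * bool) (i j k : 'I_n) :
  t \in cmp3_values ->
  (lex_count (true, true, true) i j k * lex_count t (tau i) (tau j) (tau k) =
    36 * ((i < j)%N * (j < k)%N *
      (((tau i < tau j)%N, (tau i < tau k)%N, (tau j < tau k)%N) == t)) +
    9 * ((i == j) * ((i < k)%N *
      (((tau i < tau k)%N, (tau i < tau k)%N) == (t.1.2, t.2)))) +
    9 * ((j == k) * ((i < j)%N *
      (((tau i < tau j)%N, (tau i < tau j)%N) == t.1))) +
    (i == j) * (j == k))%N.
Proof.
move=> tk.
have tneq (x y : 'I_n) : val x != val y -> val (tau x) != val (tau y).
  by rewrite !(inj_eq val_inj) (inj_eq perm_inj).
have [->|ij] := eqVneq i j.
  rewrite ltnn /=; have [->|jk] := eqVneq j k.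
    by rewrite !lex_count_all tk ltnn.
  rewrite !lex_count_first ?tneq //.
  by case: (j < k)%N => //=; lia.
have [<-|jk] := eqVneq j k.
  rewrite !lex_count_last ?tneq // ltnn.
  by case: (i < j)%N => //=; lia.
rewrite !mul0n !muln0 !addn0.
have [<-|ik] := eqVneq i k.
  have nij : (i : nat) != j by rewrite (inj_eq val_inj).
  have -> : lex_count (true, true, true) i j i = 0%N.
    by rewrite /lex_count /lex_cmp3 /= !ltnn !eqxx; case: (ltngtP i j) nij.
  by case: (ltngtP i j) nij.
rewrite !lex_count_distinct ?tneq //.
have -> : ((((i < j)%N, (i < k)%N, (j < k)%N) == (true, true, true)) =
  (i < j) && (j < k))%N.
  rewrite !xpair_eqE !eqb_id; case: (ltnP i j) => //= lij;
    case: (ltnP j k) => //= ljk.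
    by rewrite (ltn_trans lij).
  by rewrite andbF.
by rewrite -mulnb; ring.
Qed.

(** The factor 36 counts all pairs of order types of three points in distinct
    blocks. When two points share a block, their order is prescribed both in
    position and in value, and 3 of the 6 order types comply each time. A
    single block leaves one order type for positions and one for values. *)
Lemma inflation_weight3E n (tau : 'S_n) (pi : 'S_3) :
  inflation_weight tau pi = (36 * triple_count tau (perm_cmp3 pi) +
    9 * pair_count tau (perm_cmp3 pi) + n)%N.
Proof.
rewrite inflation_weight3_sumE; set t := perm_cmp3 pi.
have tk : t \in cmp3_values by exact: perm_cmp3_in.
pose f1 (i j k : 'I_n) := ((i < j)%N * (j < k)%N *
  (((tau i < tau j)%N, (tau i < tau k)%N, (tau j < tau k)%N) == t))%N.
pose f2 (i k : 'I_n) :=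
  ((i < k)%N * (((tau i < tau k)%N, (tau i < tau k)%N) == (t.1.2, t.2)))%N.
pose f3 (i j : 'I_n) :=
  ((i < j)%N * (((tau i < tau j)%N, (tau i < tau j)%N) == t.1))%N.
pose g2 (i j k : 'I_n) := ((i == j) * f2 i k)%N.
pose g3 (i j k : 'I_n) := ((j == k) * f3 i j)%N.
transitivity (sum3 (fun i j k : 'I_n =>
    36 * f1 i j k + 9 * g2 i j k + 9 * g3 i j k + (i == j) * (j == k))%N).
  by apply: eq_sum3 => i j k; apply: lex_count_mul.
rewrite (sum3D (fun i j k => 36 * f1 i j k + 9 * g2 i j k + 9 * g3 i j k)%N).
rewrite (sum3D (fun i j k => 36 * f1 i j k + 9 * g2 i j k)%N).
rewrite (sum3D (fun i j k => 36 * f1 i j k)%N) (sum3M 36 f1) (sum3M 9 g2)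
  (sum3M 9 g3).
rewrite (sum3_delta12 f2) (sum3_delta23 f3).
have -> : sum3 (fun i j k : 'I_n => (i == j) * (j == k))%N = n.
  rewrite -[RHS]card_ord -sum1_card; apply: eq_bigr => i _.
  rewrite -(sum_delta i (fun=> 1%N)); apply: eq_bigr => j _.
  by rewrite -big_distrr /= -(sum_delta j (fun=> 1%N)); congr (_ * _)%N;
    apply: eq_bigr => k _; rewrite muln1.
have -> : pair_count tau t = (sum2 f2 + sum2 f3)%N.
  by rewrite -sum2D; apply: eq_sum2 => i j; rewrite mulnDr.
by rewrite mulnDr !addnA.
Qed.

(** A pair [i < j] extends to a triple by any third index, and the [n] choices
    of [k] are those extensions together with [k = i] and [k = j]. *)
Lemma ascending_pair_extensions n (a : 'I_n -> 'I_n -> nat) :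
  (sum3 (fun i j k : 'I_n => (i < j)%N * (j < k)%N * (a i j + a i k + a j k)) +
   2 * sum2 (fun i j : 'I_n => (i < j)%N * a i j) =
   n * sum2 (fun i j : 'I_n => (i < j)%N * a i j))%N.
Proof.
have -> : (sum3 (fun i j k : 'I_n =>
  (i < j)%N * (j < k)%N * (a i j + a i k + a j k)) =
  sum3 (fun i j k : 'I_n =>
    ((i < j)%N * (j < k)%N + (i < k)%N * (k < j)%N + (k < i)%N * (i < j)%N) * a
      i j))%N.
  rewrite (eq_sum3 (g := fun i j k => (i < j)%N * (j < k)%N * a i j
     + (i < j)%N * (j < k)%N * a i k + (i < j)%N * (j < k)%N * a j k)%N);
       last first.
    by move=> i j k; rewrite !mulnDr.
  rewrite [RHS](eq_sum3 (g := fun i j k => (i < j)%N * (j < k)%N * a i j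
     + (i < k)%N * (k < j)%N * a i j + (k < i)%N * (i < j)%N * a i j)%N);
       last first.
    by move=> i j k; rewrite !mulnDl.
  rewrite !sum3D; congr (_ + _ + _)%N; first by rewrite -sum3_swap23.
  pose f (i j k : 'I_n) := ((k < i)%N * (i < j)%N * a i j)%N.
  exact: etrans (sum3_swap12 (fun i j k => f i k j)) (sum3_swap23 f).
rewrite /sum3 /sum2 !big_distrr -big_split; apply: eq_bigr => i _ /=.
rewrite !big_distrr -big_split; apply: eq_bigr => j _ /=.
rewrite -big_distrl /= mulnA -mulnDl mulnA; congr (_ * _)%N.
have [ij|ji] := ltnP i j; last first.
  rewrite !muln0 addn0; apply: big1 => k _; rewrite muln0 addn0 add0n.
  by case: ltnP => //= ik; case: ltnP => //= kj; move: (ltn_trans ik kj);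
    rewrite ltnNge ji.
rewrite !muln1; transitivity (\sum_(k < n) 1)%N;
  last by rewrite sum_nat_const card_ord muln1.
rewrite (_ : 2%N = \sum_(k < n) ((i == k) * 1 + (j == k) * 1))%N; last first.
  by rewrite big_split /= !sum_delta.
rewrite -big_split; apply: eq_bigr => k _ /=.
rewrite -!(inj_eq val_inj) /= !muln1 mul1n.
by case: (ltngtP i k) => ik; case: (ltngtP j k) => jk //=; move: ij ik jk; lia.
Qed.

Lemma pairs_total n (tau : 'S_n) :
  (2 * (sum2 (fun i j : 'I_n => (i < j)%N * (tau i < tau j)%N) +
    sum2 (fun i j : 'I_n => (i < j)%N * ~~ (tau i < tau j)%N)) + n = n * n)%N.
Proof.
rewrite -sum2D (eq_sum2 (g := fun i j => (i < j)%N)); last first.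
  by move=> i j; case: (i < j)%N; case: (tau i < tau j)%N.
have -> : (2 * sum2 (fun i j : 'I_n => (i < j)%N))%N =
    sum2 (fun i j : 'I_n => (i < j)%N + (j < i)%N)%N.
  by rewrite sum2D mul2n -addnn; congr addn; rewrite /sum2 exchange_big.
have eqn : n = sum2 (fun i j : 'I_n => (i == j) * 1)%N.
  rewrite -{1}(card_ord n) -sum1_card; apply: eq_bigr => i _.
  by rewrite (sum_delta i (fun=> 1%N)).
rewrite [X in (_ + X)%N]eqn -sum2D (eq_sum2 (g := fun _ _ => 1%N)).
  by rewrite /sum2 !sum_nat_const !card_ord muln1.
by move=> i j; rewrite -(inj_eq val_inj) /=; case: ltngtP.
Qed.

(** * Inflatable permutations *)

(** There are countably many patterns. *)
Lemma all_densities_cvg_ae (R : realType) n (tau : 'S_n)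
    d (Omega : measurableType d) (P : probability Omega R)
    (la : forall l, Omega -> 'S_l.+1) :
  (0 < n)%N -> (forall l, uniform_perm P (la l)) ->
  {ae P, forall w, forall m (pi : 'S_m), (0 < m)%N ->
    density R pi (tensor tau (la l w)) @[l --> \oo] -->
    ((inflation_weight tau pi)%:R / (m`! * n ^ m)%:R : R)}.
Proof.
move=> n0 unif.
(* Patterns of all lengths are enumerated through pickle. *)
pose Q k w := if @unpickle {m : nat & 'S_m} k is Some p then (0 < tag p)%N ->
    density R (tagged p) (tensor tau (la l w)) @[l --> \oo] -->
    ((inflation_weight tau (tagged p))%:R / ((tag p)`! * n ^ (tag p))%:R : R)
      else True.
have ae_Q k : {ae P, forall w, Q k w}.
  rewrite /Q; case: unpickle => [[m pi]|]; last by apply: aeW.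
  case: m pi => [|m] pi; first by apply: aeW.
  by apply: filterS (density_cvg_ae tau pi n0 (ltn0Sn m) unif) => w lim _.
apply: filterS (ae_foralln ae_Q) => w Qw m pi m0.
have := Qw (pickle (Tagged (fun m => 'S_m) pi)).
by rewrite /Q pickleK /=; apply.
Qed.

(** The almost sure limits are deterministic. For the direct implication they
    are compared with [1 / k!] at one point of the unit interval. *)
Lemma inflatableP (R : realType) k n (tau : 'S_n) : (0 < n)%N -> (0 < k)%N ->
  inflatable R k tau <-> forall pi : 'S_k, inflation_weight tau pi = (n ^ k)%N.
Proof.
move=> n0 k0.
have limE (pi : 'S_k) : inflation_weight tau pi = (n ^ k)%N <->
    (inflation_weight tau pi)%:R / (k`! * n ^ k)%:R = (k`!%:R^-1 : R).
  have f0 : k`!%:R != 0 :> R by rewrite pnatr_eq0 -lt0n fact_gt0.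
  have nk0 : (n ^ k)%:R != 0 :> R by rewrite pnatr_eq0 -lt0n expn_gt0 n0.
  rewrite natrM invfM mulrCA; split => [->|e]; first by rewrite mulfV // mulr1.
  apply/eqP; rewrite -(eqr_nat R); apply/eqP.
  by rewrite -[LHS](divfK nk0)
    (mulfI (invr_neq0 f0) (etrans e (esym (mulr1 _)))) mul1r.
split=> [infl pi|wt d Omega P la unif]; last first.
  apply: filterS (all_densities_cvg_ae tau n0 unif) => w lims; split.
  - apply/cvgnyPge => A; exists A => // l /= Al.
    by apply: leq_trans (leq_trans Al (leqnSn l)) _; rewrite leq_pmull.
  - by move=> m pi m0; apply/cvg_ex; eexists; apply: lims.
  by move=> pi; rewrite -(proj1 (limE pi) (wt pi)); apply: lims.
have unif l := @unit_perm_uniform R l.+1.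
have pos : (0 < @unit_prob R setT)%E by rewrite unit_prob_setT lte_fin ltr01.
have [w [sym lims]] := @filter_ex _ _ (ae_properfilter_algebraOfSetsType pos) _
  (filterI (infl _ _ (@unit_prob R) _ unif) (all_densities_cvg_ae tau n0 unif)).
case: sym => _ _ /(_ pi) sym; apply/limE.
exact: cvg_unique (lims k pi k0) sym.
Qed.

(** The shifted word of a 3-inflatable permutation: it has 68 ascending and 68
    descending pairs, 102 occurrences of each of 123 and 321, and 119 of each
    other pattern of length 3. *)
Definition table17 : seq nat :=
    [:: 9; 1; 13; 14; 3; 10; 8; 5; 16; 0; 4; 11; 7; 15; 6; 2; 12]%N.

Definition fun17 (i : 'I_17) : 'I_17 := inord (nth 0%N table17 i).

Lemma fun17_val i : fun17 i = nth 0%N table17 i :> nat.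
Proof.
have /seq.allP small : all (fun x => x < 17)%N table17 by [].
by rewrite inordK // small // mem_nth.
Qed.

Lemma fun17_inj : injective fun17.
Proof.
move=> i j /(congr1 val); rewrite /= !fun17_val => /eqP.
by rewrite nth_uniq // => /eqP/val_inj.
Qed.

Definition perm17 : 'S_17 := perm fun17_inj.

Lemma sum_ord_sumn n (F : nat -> nat) :
    (\sum_(i < n) F i = sumn [seq F i | i <- iota 0 n])%N.
Proof. by rewrite sumnE big_map -(big_mkord xpredT F) /index_iota subn0. Qed.

Lemma inflation_weight_perm17 (pi : 'S_3) : inflation_weight perm17 pi =
    (17 ^ 3)%N.
Proof.
pose W t := sumn [seq sumn [seq sumn [seq
    (lex_count (true, true, true) i j k *
     lex_count t (nth 0 table17 i) (nth 0 table17 j) (nth 0 table17 k))%N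
   | k <- iota 0 17] | j <- iota 0 17] | i <- iota 0 17].
have WE : all (fun t => W t == 4913) cmp3_values by vm_compute.
rewrite inflation_weight3_sumE -[RHS](eqP (seq.allP WE _ (perm_cmp3_in pi))) /W.
rewrite -sum_ord_sumn; apply: eq_bigr => i _; rewrite -sum_ord_sumn;
  apply: eq_bigr => j _.
by rewrite -sum_ord_sumn; apply: eq_bigr => k _; rewrite !permE !fun17_val.
Qed.

(** The equations of five patterns are linear in the pattern counts once [n] is
    given. With the two double counts they force [144 T = n (n - 1) (4 n - 5)],
    where [T] is the number of occurrences of 132, and no [n] in the range
    satisfies this. *)
Lemma no_short_inflation_weight n (tau : 'S_n) :
  (forall pi : 'S_3, inflation_weight tau pi = (n ^ 3)%N) -> (2 <= n <= 16)%N ->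
    False.
Proof.
move=> wt nb.
have wk t : t \in cmp3_values ->
  (36 * triple_count tau t + 9 * pair_count tau t + n = n ^ 3)%N.
  by move=> /perm_cmp3_onto [pi <-]; rewrite -inflation_weight3E.
pose asc := sum2 (fun i j : 'I_n => (i < j)%N * (tau i < tau j)%N)%N.
pose desc := sum2 (fun i j : 'I_n => (i < j)%N * ~~ (tau i < tau j)%N)%N.
have total : (2 * (asc + desc) + n = n * n)%N := pairs_total tau.
have [p1 p2 p3 p4 p5] : [/\ pair_count tau (true, true, true) = asc + asc,
   pair_count tau (true, true, false) = asc,
   pair_count tau (false, true, true) = asc,
   pair_count tau (true, false, false) = desc &
   pair_count tau (false, false, true) = desc]%N.
  by split; rewrite -?sum2D; apply: eq_sum2 => i j; case: (i < j)%N;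
    case: (tau i < tau j)%N.
(* The coefficient of a pattern is its number of ascending pairs. *)
have dbl : (3 * triple_count tau (true, true, true) +
   2 * triple_count tau (true, true, false) +
     2 * triple_count tau (false, true, true) +
   triple_count tau (true, false, false) +
     triple_count tau (false, false, true) +
   2 * asc = n * asc)%N.
  rewrite -[RHS](ascending_pair_extensions
    (fun i j : 'I_n => (tau i < tau j)%N : nat)); congr (_ + _)%N.
  rewrite -!sum3M -!sum3D; apply: eq_sum3 => i j k.
  case: (ltnP i j) => _; rewrite ?mul0n ?muln0 //; case: (ltnP j k) => _ //.
  by case: (ltnP (tau i) (tau j)) => h1; case: (ltnP (tau i) (tau k)) => h2;
    case: (ltnP (tau j) (tau k)) => h3 //; move: h1 h2 h3; lia.
have := wk (true, true, true) isT; have := wk (true, true, false) isT.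
have := wk (false, true, true) isT; have := wk (true, false, false) isT.
have := wk (false, false, true) isT.
rewrite p1 p2 p3 p4 p5; move: dbl total.
move: (triple_count _ _) (triple_count _ _) (triple_count _ _)
  (triple_count _ _)
  (triple_count _ _) => t1 t2 t3 t4 t5.
move: asc desc {wt wk p1 p2 p3 p4 p5} => asc desc; clear tau.
move: nb; do 17 (case: n => [|n]; first by move=> *; lia).
by rewrite andbF.
Qed.

Theorem mainTheorem5 (R : realType) :
  (exists tau : 'S_17, inflatable R 3 tau) /\
  (forall n : nat, (2 <= n <= 16)%N ->
     ~ (exists tau : 'S_n, inflatable R 3 tau)).
Proof.
split; first by exists perm17; apply/inflatableP => //;
  exact: inflation_weight_perm17.
move=> n nb [tau /inflatableP];
  rewrite (leq_trans _ (proj1 (andP nb))) // => wt.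
by apply: (no_short_inflation_weight (tau := tau)) => //; apply: wt.
Qed.
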